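(* (i) Let $k>1/2$ be a real number with $k\neq 1$. Then Cardy's formula does not hold for critical site percolation on the family of lattices $\{\mathcal{T}_\delta(k)\}_{\delta>0}$. (ii) Cardy's formula does not hold for critical site percolation on the family of lattices $\{\mathcal{S}^{ne}_\delta\}_{\delta>0}$. Here ''Cardy's formula does not hold'' on a family means that it is not true that for every Jordan domain $D$ with marked boundary points $a,x,b,c$ (with $x$ on the arc $\overline{ab}$) one has $\lim_{\delta\to 0}\pi_\delta(D,\overline{ax},\overline{bc})=X$, where $X=\phi(x)$ is the image of $x$ under the conformal map $\phi$ of $D$ onto the unit equilateral triangle sending $a,b,c$ to $0,1,e^{i\pi/3}$.
   Context: Identify $\mathbf{R}^2$ with $\mathbf{C}$. **The lattice $\mathcal{T}_\delta(k)$** ($\delta>0$, $k>1/2$). It is the graph obtained by dividing $\mathbf{R}^2$ into isosceles triangles with horizontal base of length $\delta$ and two equal sides of length $k\delta$, using horizontal lines and the lines through the points $(\delta m,0)$, $m\in\mathbf{Z}$, making angles $\theta$ and $\pi-\theta$ with the first coordinate axis, where $0<\theta<\pi/2$ and $2k\cos\theta=1$. Explicitly, with $h=\sqrt{k^2-1/4}$, the vertices are the points $(\delta(m+j/2),\,\delta j h)$, $m,j\in\mathbf{Z}$, and two vertices are joined by a straight edge if and only if their difference is $\pm(\delta,0)$, $\pm(\delta/2,\delta h)$ or $\pm(-\delta/2,\delta h)$. For $k=1$ this is the equilateral triangular lattice of mesh $\delta$. **The lattice $\mathcal{S}^{ne}_\delta$** ($\delta>0$). It is the square lattice of mesh $\delta$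 with one north-east diagonal added in each square: the vertices are $(\delta i,\delta j)$, $i,j\in\mathbf{Z}$, and two vertices are joined by a straight edge if and only if their difference is $\pm(\delta,0)$, $\pm(0,\delta)$ or $\pm(\delta,\delta)$. **Site percolation.** On a graph $\mathcal{G}$ of mesh $\delta$ from one of these families, each vertex is independently open with probability $p$ and closed with probability $1-p$; the corresponding probability measure is $\mathbf{P}_{p,\delta}$. A path is a finite sequence of distinct vertices in which consecutive vertices are joined by an edge; it is open if all its vertices are open. The open cluster $\mathbf{C}(\mathbf{0})$ of the origin is the set of vertices connected to the origin by an open path. The critical probability is $p_c=\sup\{p:\mathbf{P}_{p,\delta}(|\mathbf{C}(\mathbf{0})|=\infty)=0\}$, which does not depend on $\delta$. Write $\mathbf{P}_\delta=\mathbf{P}_{p_c,\delta}$. **Crossing probabilities.** A Jordan domain $D\subset\mathbf{C}$ is a bounded simply connected domain whose boundary $\partial D$ is a Jordan curve. Let $a,x,b,c$ be four distinct points of $\partial D$ in counterclockwise order, so that $\partial D=\overline{ax}\cup\overline{xb}\cup\overline{bc}\cup\overline{ca}$, where $\overline{uv}$ denotes the boundary arc from $u$ to $v$ counterclockwise, and $x$ lies on the arc $\overline{ab}$. Define $$\pi_\delta(D,\overline{ax},\overline{bc})=\mathbf{P}_\delta\big(\text{there exists an open path in } D \text{ from } \overline{ax} \text{ to } \overline{bc}\big).$$ Convention: there is an open path in $D$ from $\overline{ax}$ to $\overline{bc}$ if there is an open path such that the polygonal curve formed by its edges contains a (possibly degenerate) sub-arc contained in the closure of $D$, with one endpoint on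 $\overline{ax}$ and the other on $\overline{bc}$. **Cardy's formula (Carleson's version).** Let $\phi$ be the unique conformal map from $D$ onto the open equilateral triangle with vertices $A=0$, $B=1$, $C=e^{i\pi/3}$ whose continuous extension to the boundary satisfies $\phi(a)=0$, $\phi(b)=1$, $\phi(c)=e^{i\pi/3}$, and set $X=\phi(x)\in\overline{AB}=[0,1]$. Cardy's formula is said to hold on the given family of lattices if for every Jordan domain $D$ and all such points $a,x,b,c$, $$\lim_{\delta\to0}\pi_\delta(D,\overline{ax},\overline{bc})=X$$ (in particular the limit exists). *)

(* Defs.v *)
From HB Require Import structures.
From mathcomp Require Import all_boot all_order all_algebra.
From mathcomp Require Import all_classical all_reals all_analysis.
From mathcomp Require Import complex.
Set Implicit Arguments.
Unset Strict Implicit.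
Unset Printing Implicit Defensive.
Import Order.TTheory GRing.Theory Num.Theory.
Import numFieldNormedType.Exports.
Local Open Scope classical_set_scope.
Local Open Scope ring_scope.
Local Open Scope complex_scope.

(* R[i] itself carries no topology in the library; its regular algebra R[i]^o
   is a normed module over R[i], with the modulus (valued in R[i]) as norm. *)
Notation plane R := (R[i]^o).

(* Vertices of every lattice are labelled by pairs of integers, and [pos] gives
   their position. Two vertices are adjacent iff the difference of their
   positions belongs to [steps]. *)
Record lattice (R : realType) := Lattice {
  pos : int * int -> plane R;
  steps : seq (plane R) }.

Definition pm (R : realType) (s : seq (plane R)) : seq (plane R) :=
  s ++ [seq - z | z <- s].

Definition adj (R : realType) (G : lattice R) : rel (int * int) :=
  fun u v => pos G v - pos G u \in steps G.

Definition lattice_T (R : realType) (k delta : R) : lattice R :=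
  let h := Num.sqrt (k ^+ 2 - 4^-1) in
  {| pos := fun v => (delta * (v.1%:~R + v.2%:~R / 2)) +i* (delta * v.2%:~R * h);
     steps := pm [:: delta +i* 0;
                     (delta / 2) +i* (delta * h);
                     (- (delta / 2)) +i* (delta * h)] |}.

Definition lattice_Sne (R : realType) (delta : R) : lattice R :=
  {| pos := fun v => (delta * v.1%:~R) +i* (delta * v.2%:~R);
     steps := pm [:: delta +i* 0; 0 +i* delta; delta +i* delta] |}.

(* [true] means open. *)
Definition config := (int * int -> bool)%type.

Definition site_events : set (set config) :=
  [set A | exists v : int * int, A = [set w : config | w v]].

Notation configT := (g_sigma_algebraType site_events).

(* P is the product measure under which every vertex is open with probability
   p; this determines P, finite cylinders being a generating pi-system. *)
Definition product_bernoulli (R : realType) (p : R)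
    (P : probability configT R) : Prop :=
  forall (s : seq (int * int)) (e : config), uniq s ->
    P [set w : config | {in s, w =1 e}] =
    (\prod_(v <- s) (if e v then p else 1 - p))%:E.

Definition open_path (R : realType) (G : lattice R) (w : config)
    (v : int * int) (s : seq (int * int)) : bool :=
  [&& path (adj G) v s, uniq (v :: s) & all w (v :: s)].

Definition cluster0 (R : realType) (G : lattice R) (w : config) :
    set (int * int) :=
  [set v | exists s, open_path G w (0, 0) s /\ last (0, 0) s = v].

(* In what follows, P p is the law of site percolation with parameter p. *)
Definition p_c (R : realType) (P : R -> probability configT R)
    (G : lattice R) : R :=
  sup [set p : R | 0 <= p <= 1 /\
    P p [set w : config | infinite_set (cluster0 G w)] = 0%E].

(* The polygonal curve through the points s_0, ..., s_n, parametrized by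
   0 <= t <= n; at t = n the default value of nth has coefficient 0. *)
Definition polyline (R : realType) (s : seq (plane R)) (t : R) : plane R :=
  let i := Num.truncn t in
  (1 - (t - i%:R))%:C * nth 0 s i + (t - i%:R)%:C * nth 0 s i.+1.

Definition crossing (R : realType) (G : lattice R) (D A B : set (plane R)) :
    set config :=
  [set w | exists v s, open_path G w v s /\
    let L := polyline [seq pos G u | u <- v :: s] in
    exists t1 t2 : R,
      [/\ 0 <= t1, t1 <= t2, t2 <= (size s)%:R,
          forall t, t1 <= t <= t2 -> closure D (L t)
        & A (L t1) /\ B (L t2) \/ B (L t1) /\ A (L t2)]].

Definition crossing_prob (R : realType) (P : R -> probability configT R)
    (G : lattice R) (D A B : set (plane R)) : R :=
  fine (P (p_c P G) (crossing G D A B)).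

Definition boundary (T : topologicalType) (D : set T) : set T :=
  closure D `\` interior D.

Definition jordan_param (R : realType) (g : R -> plane R)
    (J : set (plane R)) : Prop :=
  [/\ {within `[0, 1], continuous g}, g 0 = g 1,
      {in `[0, 1[ &, injective g} & g @` `[0, 1] = J].

Definition simply_connected (R : realType) (D : set (plane R)) : Prop :=
  connected D /\
  forall g : R -> plane R, {within `[0, 1], continuous g} -> g 0 = g 1 ->
    g @` `[0, 1] `<=` D ->
    exists (H : R * R -> plane R) (z0 : plane R),
      [/\ {within `[0, 1] `*` `[0, 1], continuous H},
          H @` (`[0, 1] `*` `[0, 1]) `<=` D,
          forall t, 0 <= t <= 1 -> H (0, t) = g t /\ H (1, t) = z0
        & forall s, 0 <= s <= 1 -> H (s, 0) = H (s, 1)].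

Definition jordan_domain (R : realType) (D : set (plane R)) : Prop :=
  [/\ D !=set0, open D, bounded_set D, simply_connected D
    & exists g, jordan_param g (boundary D)].

Definition expi (R : realType) (x : R) : plane R := cos x +i* sin x.

(* The closed curve g, which avoids z, has winding number n around z. *)
Definition winds (R : realType) (g : R -> plane R) (z : plane R) (n : int) :
    Prop :=
  exists th : R -> R,
    [/\ {within `[0, 1], continuous th},
        forall t, 0 <= t <= 1 -> g t - z = `|g t - z| * expi (th t)
      & th 1 - th 0 = 2 * pi * n%:~R].

Definition ccw_param (R : realType) (D : set (plane R)) (g : R -> plane R) :
    Prop :=
  jordan_param g (boundary D) /\ forall z, D z -> winds g z 1.

Definition ccw4 (R : realType) (D : set (plane R)) (a x b c : plane R) : Prop :=
  exists (g : R -> plane R) (tx tb tc : R),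
    [/\ ccw_param D g, [/\ 0 < tx, tx < tb, tb < tc & tc < 1]
      & [/\ g 0 = a, g tx = x, g tb = b & g tc = c]].

(* The closed arc of the boundary of D from u to v counterclockwise. *)
Definition bdarc (R : realType) (D : set (plane R)) (u v : plane R) :
    set (plane R) :=
  [set z | exists (g : R -> plane R) (t : R),
    [/\ ccw_param D g, g 0 = u, 0 <= t < 1, g t = v & (g @` `[0, t]) z]].

Definition triangle (R : realType) (A B C : plane R) : set (plane R) :=
  [set z | exists r s t : R, [/\ 0 < r, 0 < s, 0 < t, r + s + t = 1
    & z = r%:C * A + s%:C * B + t%:C * C]].

(* phi is defined on the whole plane, but only its values on the closure of D
   matter; derivability is with respect to the complex field. *)
Definition cardy_map (R : realType) (D : set (plane R)) (a b c : plane R)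
    (phi : plane R -> plane R) : Prop :=
  let A : plane R := 0 in
  let B : plane R := 1 in
  let C : plane R := expi (pi / 3) in
  [/\ forall z, D z -> derivable phi z 1,
      set_bij D (triangle A B C) phi,
      {within closure D, continuous phi}
    & [/\ phi a = A, phi b = B & phi c = C]].

Definition cardy_formula (R : realType) (P : R -> probability configT R)
    (G : R -> lattice R) : Prop :=
  forall (D : set (plane R)) (a x b c : plane R) (phi : plane R -> plane R)
    (X : R),
    jordan_domain D -> ccw4 D a x b c -> cardy_map D a b c phi ->
    phi x = X%:C ->
    crossing_prob P (G delta) D (bdarc D a x) (bdarc D b c)
      @[delta --> 0^'+] --> X.

(* Main.v *)
Require Import Defs.
From mathcomp Require Import all_boot all_order all_algebra.
From mathcomp Require Import all_classical all_reals all_analysis.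
From mathcomp Require Import complex.
From mathcomp Require Import ring lra.

(** Both families of lattices are linear images of the triangular lattice, so
    that their vertices and edges have a symmetry of order six which is the
    restriction of a linear map M of the plane. Site percolation is invariant
    under M: a domain with four marked points and its image by M have the same
    crossing probabilities, for every mesh. When M is not a similarity, this is
    incompatible with Cardy's formula, by a comparison of exponents.

    Let T be an equilateral triangle of vertices 0, u and u omega, where
    omega = expi (pi / 3), with marked points 0, x, u, u omega and x close to 0.
    Cardy's formula for T says that the crossing probability tends to X = x / u.
    On the other hand, as M preserves orientation and is not a similarity, u can
    be chosen such that M opens the angle of T at 0 ([wide_angle],
    [wedge_choice]): M T has there an angle larger than pi / 3, and contains near
    0 a sector of opening g pi / 3 for some g > 1. The image S of an equilateral
    triangle by w |-> c w^g is such a sector, and its conformal map onto the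
    triangle is explicit, namely z |-> (z / c)^(1/g). If S is large enough, any
    crossing of S from the initial segment of its first side to its far side
    contains a crossing of M T ([crossing_transfer]). So Cardy's formula for S
    bounds X below by a constant multiple of X^(1/g), which is absurd for X small
    ([no_cardy_wedge]).

    No Riemann mapping theorem is needed, as all the conformal maps are powers.
    The exponent g is taken of the form (n + 1) / n. In the variable u = w^(1/n),
    both w and w^g are powers of u, and the quotient of two differences of such
    powers is a quotient of polynomials. This gives the derivative of the
    conformal map ([secdom_derivable]), and shows that the boundary curve of S
    winds once around each point of S, as the boundary of the triangle does
    ([winds_secmap], [winds_tricurve]). The boundary arcs of the statement are
    defined through arbitrary positively oriented parametrizations of the
    boundary. Any two of these differ by an increasing change of parameter, since
    a decreasing one would reverse the winding number ([bdarcE]). Finally, the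
    invariance of the percolation measure comes from the uniqueness of measures
    that agree on the events that finitely many given sites are open
    ([relabel_prob]). *)

Set Implicit Arguments.
Unset Strict Implicit.
Unset Printing Implicit Defensive.
Import Order.TTheory GRing.Theory Num.Theory.
Import numFieldNormedType.Exports.
Local Open Scope classical_set_scope.
Local Open Scope ring_scope.
Local Open Scope complex_scope.

Local Notation Re := (@complex.Re _).
Local Notation Im := (@complex.Im _).

(** * The modulus and limits in the plane *)

Section Plane.
Context {R : realType}.
Implicit Types z w : plane R.

(** The modulus as a real number: the norm of the plane takes values in R[i]. *)
Definition cmod z : R := Num.sqrt (Re z ^+ 2 + Im z ^+ 2).

Lemma normE z : `|z| = (cmod z)%:C.
Proof. by rewrite -normc_def. Qed.

Lemma cmod_ge0 z : 0 <= cmod z.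
Proof. exact: sqrtr_ge0. Qed.

Lemma ltCR (x y : R) : (x%:C < y%:C :> R[i]) = (x < y).
Proof. by rewrite ltcE /= eqxx. Qed.

Lemma leCR (x y : R) : (x%:C <= y%:C :> R[i]) = (x <= y).
Proof. by rewrite lecE /= eqxx. Qed.

Lemma cReD z w : Re (z + w) = Re z + Re w. Proof. by case: z; case: w. Qed.
Lemma cImD z w : Im (z + w) = Im z + Im w. Proof. by case: z; case: w. Qed.
Lemma cReN z : Re (- z) = - Re z. Proof. by case: z. Qed.
Lemma cImN z : Im (- z) = - Im z. Proof. by case: z. Qed.
Lemma cReB z w : Re (z - w) = Re z - Re w. Proof. by case: z; case: w. Qed.
Lemma cImB z w : Im (z - w) = Im z - Im w. Proof. by case: z; case: w. Qed.
Lemma cReM z w : Re (z * w) = Re z * Re w - Im z * Im w.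
Proof. by case: z; case: w. Qed.
Lemma cImM z w : Im (z * w) = Re z * Im w + Im z * Re w.
Proof. by case: z; case: w. Qed.
Lemma complexP z w : Re z = Re w -> Im z = Im w -> z = w.
Proof. by case: z => a b; case: w => c d /= -> ->. Qed.

Lemma cmodM z w : cmod (z * w) = cmod z * cmod w.
Proof.
rewrite /cmod -sqrtrM ?addr_ge0 ?sqr_ge0 // cReM cImM; congr Num.sqrt; ring.
Qed.

Lemma cmod0 : cmod 0 = 0.
Proof. by rewrite /cmod /= expr0n addr0 sqrtr0. Qed.

Lemma cmod_eq0 z : (cmod z == 0) = (z == 0).
Proof.
have -> : (z == 0) = (`|z| == 0) by rewrite normr_eq0.
by rewrite normE eq_complex /= eqxx andbT.
Qed.

Lemma cmod_gt0 z : (0 < cmod z) = (z != 0).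
Proof. by rewrite lt0r cmod_eq0 cmod_ge0 andbT. Qed.

Lemma cmod_real (x : R) : cmod x%:C = `|x|.
Proof. by rewrite /cmod /= expr0n addr0 sqrtr_sqr. Qed.

Lemma cmodD z w : cmod (z + w) <= cmod z + cmod w.
Proof. by rewrite -leCR raddfD /= -!normE ler_normD. Qed.

Lemma cmodN z : cmod (- z) = cmod z.
Proof. by rewrite /cmod cReN cImN !sqrrN. Qed.

Lemma cmodE2 z : cmod z ^+ 2 = Re z ^+ 2 + Im z ^+ 2.
Proof. by rewrite sqr_sqrtr // addr_ge0 ?sqr_ge0. Qed.

Lemma Re_le_cmod z : `|Re z| <= cmod z.
Proof. by rewrite -sqrtr_sqr ler_wsqrtr // lerDl sqr_ge0. Qed.

Lemma Im_le_cmod z : `|Im z| <= cmod z.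
Proof. by rewrite -sqrtr_sqr ler_wsqrtr // lerDr sqr_ge0. Qed.

Lemma cmod_le z : cmod z <= `|Re z| + `|Im z|.
Proof.
have {1}-> : z = (Re z)%:C + 0 +i* (Im z) by apply: complexP => /=; ring.
apply: le_trans (cmodD _ _) _; rewrite cmod_real lerD2l /cmod /=.
by rewrite expr0n add0r sqrtr_sqr.
Qed.

(** Convergence in the plane, tested with real radii. *)
Lemma cvg_plane_dist (T : Type) (F : set_system T) (FF : Filter F)
    (f : T -> plane R) z :
  f @ F --> z <-> forall e : R, 0 < e -> \forall t \near F, cmod (z - f t) < e.
Proof.
split.
  move=> /cvgrPdist_lt h e e0.
  have e0' : (0 : R[i]) < e%:C by rewrite (ltCR 0).
  by apply: filterS (h _ e0') => t; rewrite normE ltCR.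
move=> h; apply/cvgrPdist_lt => e.
case: e => e1 e2; rewrite ltcE /= => /andP[/eqP-> e0].
by apply: filterS (h _ e0) => t; rewrite normE ltcE /= eqxx.
Qed.

Lemma continuous_Re : continuous (Re : plane R -> R).
Proof.
move=> z; apply/(@cvgrPdist_lt _ _ _ (nbhs z)) => e e0.
have FF : Filter (nbhs z) by exact: nbhs_filter.
have [+ _] := cvg_plane_dist FF id z => /(_ (@cvg_id _ _) e e0).
by apply: (@filterS _ (nbhs z)) => w; apply: le_lt_trans; rewrite -cReB Re_le_cmod.
Qed.

Lemma continuous_Im : continuous (Im : plane R -> R).
Proof.
move=> z; apply/(@cvgrPdist_lt _ _ _ (nbhs z)) => e e0.
have FF : Filter (nbhs z) by exact: nbhs_filter.
have [+ _] := cvg_plane_dist FF id z => /(_ (@cvg_id _ _) e e0).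
by apply: (@filterS _ (nbhs z)) => w; apply: le_lt_trans; rewrite -cImB Im_le_cmod.
Qed.

Lemma cvg_plane (T : Type) (F : set_system T) (FF : Filter F)
    (f : T -> plane R) z :
  Re (f t) @[t --> F] --> Re z -> Im (f t) @[t --> F] --> Im z -> f @ F --> z.
Proof.
move=> /cvgrPdist_lt hr /cvgrPdist_lt hi; apply/cvg_plane_dist => e e0.
have e2 : 0 < e / 2 by rewrite divr_gt0.
near=> t; apply: le_lt_trans (cmod_le _) _; rewrite cReB cImB [e]splitr.
by apply: ltrD; near: t; [exact: hr|exact: hi].
Unshelve. all: by end_near. Qed.

Lemma cvg_Re (T : Type) (F : set_system T) (FF : Filter F)
    (f : T -> plane R) z :
  f @ F --> z -> Re (f t) @[t --> F] --> Re z.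
Proof. by move=> h; apply: continuous_cvg => //; exact: continuous_Re. Qed.

Lemma cvg_Im (T : Type) (F : set_system T) (FF : Filter F)
    (f : T -> plane R) z :
  f @ F --> z -> Im (f t) @[t --> F] --> Im z.
Proof. by move=> h; apply: continuous_cvg => //; exact: continuous_Im. Qed.

Lemma cvg_cmod (T : Type) (F : set_system T) (FF : Filter F)
    (f : T -> plane R) z :
  f @ F --> z -> cmod (f t) @[t --> F] --> cmod z.
Proof.
move=> h; apply: (@continuous_cvg _ _ _ _ _ _ Num.sqrt).
  exact: sqrt_continuous.
by apply: cvgD; rewrite expr2; [apply: cvgM; exact: cvg_Re|apply: cvgM; exact: cvg_Im].
Qed.

Lemma cvg_add (T : Type) (F : set_system T) (FF : Filter F)
    (g h : T -> plane R) u v :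
  g @ F --> u -> h @ F --> v -> g i + h i @[i --> F] --> u + v.
Proof. by move=> gu hv; exact: cvgD gu hv. Qed.

Lemma cvg_mul (T : Type) (F : set_system T) (FF : Filter F)
    (f g : T -> plane R) (a b : plane R) :
  f @ F --> a -> g @ F --> b -> f i * g i @[i --> F] --> a * b.
Proof.
move=> fa gb; have fr := cvg_Re FF fa; have fi := cvg_Im FF fa.
have gr := cvg_Re FF gb; have gi := cvg_Im FF gb.
apply: cvg_plane; rewrite ?cReM ?cImM.
  under eq_fun do rewrite cReM.
  by apply: cvgB; apply: cvgM.
under eq_fun do rewrite cImM.
by apply: cvgD; apply: cvgM.
Qed.

Lemma cvg_expn (T : Type) (F : set_system T) (FF : Filter F) (f : T -> plane R)
    (z : plane R) k :
  f @ F --> z -> f i ^+ k @[i --> F] --> z ^+ k.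
Proof.
move=> fz; elim: k => [|k IHk]; first exact: cvg_cst.
have -> : (fun i => f i ^+ k.+1) = (fun i => f i * f i ^+ k).
  by apply/funext => i; rewrite exprS.
rewrite exprS; exact: (cvg_mul FF fz IHk).
Qed.

Lemma cvg_rC (T : Type) (F : set_system T) (FF : Filter F) (f : T -> R) (x : R) :
  f @ F --> x -> ((f t)%:C : plane R) @[t --> F] --> (x%:C : plane R).
Proof. by move=> fx; apply: cvg_plane => //=; exact: cvg_cst. Qed.

End Plane.

(** * Polar form *)

Section PolarForm.
Context {R : realType}.
Implicit Types (z w : plane R) (x y r t : R).

Lemma expiD x y : expi (x + y) = expi x * expi y :> plane R.
Proof. by apply: complexP; rewrite ?cReM ?cImM /= ?cosD ?sinD //; ring. Qed.

Lemma expi0 : expi 0 = 1 :> plane R.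
Proof. by rewrite /expi cos0 sin0. Qed.

Lemma expiX x n : expi x ^+ n = expi (x *+ n) :> plane R.
Proof.
elim: n => [|n IHn]; first by rewrite expr0 mulr0n expi0.
by rewrite exprS IHn mulrS expiD.
Qed.

Lemma cmod_expi x : cmod (expi x) = 1.
Proof. by rewrite /cmod /= cos2Dsin2 sqrtr1. Qed.

Lemma expi_neq0 x : expi x != 0 :> plane R.
Proof. by rewrite -cmod_gt0 cmod_expi. Qed.

Lemma cvg_expi (T : Type) (F : set_system T) (FF : Filter F) (f : T -> R) x :
  f @ F --> x -> expi (f t) @[t --> F] --> expi x.
Proof.
move=> fx; apply: cvg_plane; rewrite /expi /=.
  by apply: continuous_cvg fx; exact: continuous_cos.
by apply: continuous_cvg fx; exact: continuous_sin.
Qed.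

Lemma expi_inj x y : expi x = expi y :> plane R -> `|x - y| < 2 * pi -> x = y.
Proof.
move=> exy xy.
have : expi (x - y) = 1 :> plane R by rewrite expiD exy -expiD subrr expi0.
move=> [c1 _]; apply/eqP; rewrite -subr_eq0 -normr_eq0.
have: cos `|x - y| = 1 by rewrite cos_norm.
have: 0 <= `|x - y| by exact: normr_ge0.
move: `|x - y| xy => d dpi d0 cd.
have c2 : cos ((d / 2) *+ 2) = 1 by rewrite -mulr_natr divfK.
have : sin (d / 2) ^+ 2 = 0.
  by rewrite sin2cos2; move: c2; rewrite cos_mulr2n; lra.
move=> /eqP; rewrite sqrf_eq0 => /eqP s0.
apply: contraT => dn0; have dp : 0 < d by rewrite lt0r dn0.
have : 0 < sin (d / 2) by apply: sin_gt0_pi; apply/andP; split; lra.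
by rewrite s0 ltxx.
Qed.

(** The principal argument, in ]-pi, pi[ outside the closed negative real
    half-line. *)
Definition Arg z : R := 2 * atan (Im z / (cmod z + Re z)).

Lemma Arg_bound z : `|Arg z| < pi.
Proof.
have := @atan_ltpi2 R (Im z / (cmod z + Re z)).
have := @atan_gtNpi2 R (Im z / (cmod z + Re z)).
by rewrite /Arg ltr_norml; lra.
Qed.

Lemma Arg_polarE z : 0 < cmod z + Re z -> z = (cmod z)%:C * expi (Arg z).
Proof.
move=> p0; set s := cmod z + Re z in p0 *.
have s2 : s ^+ 2 + Im z ^+ 2 = 2 * cmod z * s.
  have := cmodE2 z; rewrite /s => h; nra.
have cz : 0 < cmod z.
  have := Re_le_cmod z; rewrite ler_norml /s in p0 * => /andP[_ h]; lra.
rewrite /Arg -/s; set t := Im z / s; set a := atan t.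
have sn0 : s != 0 by rewrite gt_eqF.
have ta : tan a = t by exact: atanK.
have ca : cos a != 0.
  by rewrite gt_eqF // cos_gt0_pihalf // atan_gtNpi2 atan_ltpi2.
have c2 : cos a ^+ 2 = s / (2 * cmod z).
  have := cos2_tan2 ca; rewrite ta => h.
  rewrite -[LHS]invrK h /t expr_div_n.
  have -> : 1 + Im z ^+ 2 / s ^+ 2 = 2 * cmod z / s.
    by apply: (mulIf (expf_neq0 2 sn0)); rewrite mulrDl divfK ?expf_neq0 // mul1r s2; field.
  by rewrite invf_div.
have sa : sin a = cos a * t by rewrite -ta /tan mulrC divfK.
have cn0 : cmod z != 0 by rewrite gt_eqF.
apply: complexP; rewrite ?cReM ?cImM /= mul0r ?subr0 ?addr0 mulr_natl.
  by rewrite cos_mulr2n c2 /s; field.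
rewrite sin_mulr2n sa mulrA -expr2 c2 /t.
by field; rewrite cn0 sn0.
Qed.

Lemma Arg_polar r t : 0 < r -> `|t| < pi -> Arg (r%:C * expi t) = t.
Proof.
move=> r0 tpi; have tb : - pi < t < pi by rewrite -ltr_norml.
have c2 : 0 < cos (t / 2).
  by apply: cos_gt0_pihalf; move/andP: tb => [t1 t2]; apply/andP; split; lra.
rewrite /Arg cmodM cmod_expi cmod_real (gtr0_norm r0) cReM cImM /=.
have -> : (r * sin t + 0 * cos t) / (r * 1 + (r * cos t - 0 * sin t)) = tan (t / 2).
  have : t = (t / 2) *+ 2 by rewrite -mulr_natr divfK.
  move: (t / 2) c2 => h ch ->; rewrite cos_mulr2n sin_mulr2n /tan; field.
  rewrite (gt_eqF ch) /=.
  have -> : r + r * (cos h ^+ 2 * 2 - 1) = r * cos h ^+ 2 * 2 by ring.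
  by rewrite !mulf_neq0 ?pnatr_eq0 ?expf_neq0 ?gt_eqF.
rewrite tanK; first by field.
by rewrite in_itv /=; move/andP: tb => [t1 t2]; apply/andP; split; lra.
Qed.

Lemma cvg_Arg (T : Type) (F : set_system T) (FF : Filter F) (f : T -> plane R) z :
  0 < cmod z + Re z -> f @ F --> z -> Arg (f t) @[t --> F] --> Arg z.
Proof.
move=> z0 fz; apply: cvgM; first exact: cvg_cst.
apply: continuous_cvg; first exact: continuous_atan.
apply: cvgM; first exact: cvg_Im.
apply: cvgV; first by rewrite gt_eqF.
by apply: cvgD; [exact: cvg_cmod|exact: cvg_Re].
Qed.

Lemma Re_gt0_slit z : 0 < Re z -> 0 < cmod z + Re z.
Proof. by move=> h; rewrite ltr_wpDl // cmod_ge0. Qed.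

End PolarForm.

(** * Roots on the right half-plane *)

Section Roots.
Context {R : realType} (n : nat).
Context (n_gt0 : (0 < n)%N).
Implicit Types (z w : plane R) (x y r t : R).

(** The n-th root of a nonnegative real number. *)
Definition rroot x : R := x `^ n%:R^-1.

Let nR0 : n%:R != 0 :> R. Proof. by rewrite pnatr_eq0 -lt0n. Qed.

Lemma rroot_ge0 x : 0 <= rroot x. Proof. exact: powR_ge0. Qed.

Lemma rrootK x : 0 <= x -> rroot x ^+ n = x.
Proof.
by move=> x0; rewrite -powR_mulrn ?rroot_ge0 // -powRrM mulVf // powRr1.
Qed.

Lemma rrootX x : 0 <= x -> rroot (x ^+ n) = x.
Proof.
by move=> x0; rewrite /rroot -powR_mulrn // -powRrM mulfV // powRr1.
Qed.

Lemma exprB_le x y : 0 <= y -> y <= x -> (x - y) ^+ n <= x ^+ n - y ^+ n.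
Proof.
move=> y0 yx; elim: n n_gt0 => // -[|k] IH _; first by rewrite !expr1.
have {}IH := IH isT; rewrite exprS [x ^+ _.+2]exprS [y ^+ _.+2]exprS.
have h1 : (x - y) * (x - y) ^+ k.+1 <= (x - y) * (x ^+ k.+1 - y ^+ k.+1).
  by apply: ler_wpM2l; rewrite ?subr_ge0.
have h2 : y ^+ k.+1 <= x ^+ k.+1 by rewrite lerXn2r // nnegrE; lra.
have h3 : 0 <= y ^+ k.+1 by exact: exprn_ge0.
nra.
Qed.

(** The n-th root is Hoelder continuous with exponent 1/n, up to and including 0. *)
Lemma rroot_dist x y : 0 <= x -> 0 <= y -> `|rroot x - rroot y| ^+ n <= `|x - y|.
Proof.
have : forall a b, 0 <= a -> 0 <= b -> rroot a <= rroot b ->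
    `|rroot a - rroot b| ^+ n <= `|a - b|.
  move=> a b a0 b0 ab; rewrite distrC [leRHS]distrC ger0_norm ?subr_ge0 //.
  apply: le_trans (exprB_le (rroot_ge0 a) ab) _.
  by rewrite !rrootK // ler_norm.
move=> h x0 y0; case: (leP (rroot x) (rroot y)) => xy; first exact: h.
by rewrite distrC [leRHS]distrC; apply: h => //; exact: ltW.
Qed.

Lemma cvg_rroot (T : Type) (F : set_system T) (FF : Filter F) (f : T -> R) x :
  (forall s, 0 <= f s) -> 0 <= x -> f @ F --> x -> rroot (f s) @[s --> F] --> rroot x.
Proof.
move=> f0 x0 /cvgrPdist_lt fx; apply/cvgrPdist_lt => e e0.
apply: filterS (fx (e ^+ n) (exprn_gt0 _ e0)) => t.
move=> h; have := le_lt_trans (rroot_dist x0 (f0 t)) h.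
apply: contraTT; rewrite -!leNgt => {}h.
by apply: lerXn2r; rewrite ?nnegrE // ltW.
Qed.

(** An n-th root on the closed right half-plane, extended to a continuous
    function on the plane by symmetry about the imaginary axis. *)
Definition croot z : plane R :=
  (rroot (cmod z))%:C * expi (Arg (`|Re z| +i* Im z) / n%:R).

Lemma cmod_croot z : cmod (croot z) = rroot (cmod z).
Proof. by rewrite cmodM cmod_expi mulr1 cmod_real ger0_norm // rroot_ge0. Qed.

Lemma rroot0 : rroot 0 = 0.
Proof. by rewrite /rroot powR0 // invr_eq0. Qed.

Lemma croot0 : croot 0 = 0.
Proof. by apply/eqP; rewrite -cmod_eq0 cmod_croot cmod0 rroot0. Qed.

(** [croot n] inverts the n-th power on the polar points whose n-th power stays
    in the closed right half-plane. *)
Lemma croot_polar r t : 0 <= r -> `|t *+ n| <= pi / 2 ->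
  croot ((r%:C * expi t) ^+ n) = r%:C * expi t.
Proof.
rewrite le_eqVlt => /predU1P[<- _|r0 tn]; first by rewrite mul0r expr0n eqn0Ngt n_gt0 croot0.
have pi0 := pi_gt0 R.
have rn : 0 < r ^+ n by exact: exprn_gt0.
have -> : (r%:C * expi t) ^+ n = (r ^+ n)%:C * expi (t *+ n) :> plane R.
  by rewrite exprMn expiX -rmorphXn.
rewrite /croot cmodM cmod_expi mulr1 cmod_real gtr0_norm // rrootX ?(ltW r0) //.
congr (_ * expi _).
have -> : `|Re ((r ^+ n)%:C * expi (t *+ n))| +i* Im ((r ^+ n)%:C * expi (t *+ n))
    = (r ^+ n)%:C * expi (t *+ n) :> plane R.
  apply: complexP => //=; rewrite ger0_norm //= mul0r subr0 mulr_ge0 ?(ltW rn) //.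
  by apply: cos_ge0_pihalf; rewrite -ler_norml.
rewrite Arg_polar //; last lra.
by rewrite -(mulr_natr t) mulfK.
Qed.

Lemma crootK z : 0 <= Re z -> croot z ^+ n = z.
Proof.
move=> z0; have [->|zn0] := eqVneq z 0; first by rewrite croot0 expr0n eqn0Ngt n_gt0.
rewrite /croot exprMn expiX -rmorphXn rrootK ?cmod_ge0 //.
rewrite -(mulr_natr (_ / _)) divfK // ger0_norm //.
have -> : Re z +i* Im z = z by apply: complexP.
by rewrite -Arg_polarE //; rewrite ltr_pwDl // cmod_gt0.
Qed.

Lemma cvg_croot (T : Type) (F : set_system T) (FF : Filter F)
    (f : T -> plane R) z :
  f @ F --> z -> croot (f s) @[s --> F] --> croot z.
Proof.
move=> fz; have hm : rroot (cmod (f s)) @[s --> F] --> rroot (cmod z).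
  by apply: cvg_rroot; [move=> s| |apply: cvg_cmod]; rewrite ?cmod_ge0.
(* At 0 the argument jumps, but the modulus of the root tends to 0. *)
have [z0|zn0] := eqVneq z 0.
  apply/cvg_plane_dist => e e0.
  have /cvgrPdist_lt/(_ e e0) := hm.
  rewrite z0 croot0 cmod0 rroot0; apply: filterS => w.
  by rewrite !sub0r normrN cmodN cmod_croot ger0_norm ?rroot_ge0.
apply: cvgM; first by apply: cvg_plane => //=; exact: cvg_cst.
apply: cvg_expi; apply: cvgM; last exact: cvg_cst.
apply: cvg_Arg => /=.
  rewrite ltr_pwDl // cmod_gt0 eq_complex /= normr_eq0.
  by move: zn0; rewrite eq_complex.
apply: cvg_plane => /=; last exact: cvg_Im.
by apply: cvg_norm; exact: cvg_Re.
Qed.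

End Roots.

(** * The equilateral triangle *)

Section Triangle.
Context {R : realType}.
Implicit Types (z w : plane R) (x y r s t : R).

(** The third vertex of the triangle. *)
Definition omega : plane R := expi (pi / 3).

Lemma expi_pi : expi pi = -1 :> plane R.
Proof. by apply: complexP; rewrite /= ?cospi ?sinpi ?oppr0. Qed.

Lemma cos_pi3 : cos (pi / 3) = 2^-1 :> R.
Proof.
have pi0 := pi_gt0 R.
have c0 : 0 < cos (pi / 3 : R) by apply: cos_gt0_pihalf; apply/andP; split; lra.
have : expi (pi / 3) ^+ 3 = -1 :> plane R.
  by rewrite expiX -(mulr_natr (pi / 3)) divfK // expi_pi.
move=> /(congr1 (@complex.Re R)).
rewrite exprS expr2 !cReM !cImM /=.
have := cos2Dsin2 (pi / 3 : R).
move: (cos _) (sin _) c0 => c s c0 cs h.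
(* The real part of (c + i s)^3 = -1 reads 4 c^3 - 3 c + 1 = 0. *)
have : (c + 1) * (2 * c - 1) ^+ 2 = 0.
  have -> : (c + 1) * (2 * c - 1) ^+ 2 =
    c * (c * c - s * s) - s * (c * s + s * c) + 1 + 3 * c * (c ^+ 2 + s ^+ 2 - 1) by ring.
  by rewrite h cs subrr mulr0 addr0 addNr.
move=> /eqP; rewrite mulf_eq0 sqrf_eq0 => /orP[]/eqP; lra.
Qed.

(** The height of the triangle. *)
Definition height : R := sin (pi / 3).

Lemma height_gt0 : 0 < height.
Proof. by have pi0 := pi_gt0 R; apply: sin_gt0_pi; apply/andP; split; lra. Qed.

Lemma height2 : height ^+ 2 = 3 / 4.
Proof. by have := cos2Dsin2 (pi / 3 : R); rewrite cos_pi3 -/height; lra. Qed.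

Lemma Re_omega : Re omega = 2^-1. Proof. exact: cos_pi3. Qed.
Lemma Im_omega : Im omega = height. Proof. by []. Qed.

(** Barycentric coordinates with respect to the triangle 0, 1, omega. *)
Definition bc1 z : R := Re z - Im z / (2 * height).
Definition bc2 z : R := Im z / height.
Definition bc0 z : R := 1 - bc1 z - bc2 z.
(** The point with barycentric coordinates (1 - s - t, s, t). *)
Definition bary s t : plane R := s%:C + t%:C * omega.

Let hn0 : height != 0. Proof. by rewrite gt_eqF // height_gt0. Qed.

Lemma bc1_bary s t : bc1 (bary s t) = s.
Proof.
by rewrite /bc1 /bary cReD cImD cReM cImM Re_omega Im_omega /=; field.
Qed.

Lemma bc2_bary s t : bc2 (bary s t) = t.
Proof. by rewrite /bc2 /bary cImD cImM Im_omega /=; field. Qed.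

Lemma baryE z : z = bary (bc1 z) (bc2 z).
Proof.
apply: complexP; rewrite /bary /bc1 /bc2 ?(cReD, cImD, cReM, cImM) Re_omega Im_omega /=;
  by field.
Qed.

Lemma bary_inj z w : bc1 z = bc1 w -> bc2 z = bc2 w -> z = w.
Proof. by move=> h1 h2; rewrite (baryE z) (baryE w) h1 h2. Qed.

(** The open triangle. *)
Definition tri : set (plane R) := triangle 0 1 omega.
(** The closed triangle. *)
Definition ctri : set (plane R) := [set z | [/\ 0 <= bc0 z, 0 <= bc1 z & 0 <= bc2 z]].

Lemma triE z : tri z <-> [/\ 0 < bc0 z, 0 < bc1 z & 0 < bc2 z].
Proof.
split.
  move=> [r [s [t [r0 s0 t0 rst ->]]]].
  have -> : r%:C * 0 + s%:C * 1 + t%:C * omega = bary s t by rewrite mulr0 add0r mulr1.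
  by rewrite /bc0 bc1_bary bc2_bary; split=> //; lra.
move=> [h0 h1 h2]; exists (bc0 z), (bc1 z), (bc2 z); split => //.
  by rewrite /bc0; ring.
by rewrite {1}(baryE z) mulr0 add0r mulr1.
Qed.

Lemma cvg_bc1 (T : Type) (F : set_system T) (FF : Filter F) (f : T -> plane R) z :
  f @ F --> z -> bc1 (f t) @[t --> F] --> bc1 z.
Proof.
move=> fz; apply: cvgB; first exact: cvg_Re.
by apply: cvgM; [exact: cvg_Im|exact: cvg_cst].
Qed.

Lemma cvg_bc2 (T : Type) (F : set_system T) (FF : Filter F) (f : T -> plane R) z :
  f @ F --> z -> bc2 (f t) @[t --> F] --> bc2 z.
Proof. by move=> fz; apply: cvgM; [exact: cvg_Im|exact: cvg_cst]. Qed.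

Lemma cvg_bc0 (T : Type) (F : set_system T) (FF : Filter F) (f : T -> plane R) z :
  f @ F --> z -> bc0 (f t) @[t --> F] --> bc0 z.
Proof.
move=> fz; apply: cvgB; last exact: cvg_bc2.
by apply: cvgB; [exact: cvg_cst|exact: cvg_bc1].
Qed.

Lemma continuous_bc0 : continuous bc0.
Proof. by move=> z; exact: (cvg_bc0 (nbhs_filter z) (@cvg_id _ _)). Qed.
Lemma continuous_bc1 : continuous bc1.
Proof. by move=> z; exact: (cvg_bc1 (nbhs_filter z) (@cvg_id _ _)). Qed.
Lemma continuous_bc2 : continuous bc2.
Proof. by move=> z; exact: (cvg_bc2 (nbhs_filter z) (@cvg_id _ _)). Qed.

Lemma tri_setI : tri = bc0 @^-1` [set x | 0 < x] `&` (bc1 @^-1` [set x | 0 < x]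
  `&` bc2 @^-1` [set x | 0 < x]).
Proof.
by apply/seteqP; split => z; [move/triE => [? ? ?]|move=> [? [? ?]]; apply/triE].
Qed.

Lemma open_tri : open tri.
Proof.
rewrite tri_setI; apply: openI; last apply: openI.
- by apply: open_comp; [move=> ? _; exact: continuous_bc0|exact: open_gt].
- by apply: open_comp; [move=> ? _; exact: continuous_bc1|exact: open_gt].
- by apply: open_comp; [move=> ? _; exact: continuous_bc2|exact: open_gt].
Qed.

Lemma ctri_setI : ctri = bc0 @^-1` [set x | 0 <= x] `&` (bc1 @^-1` [set x | 0 <= x]
  `&` bc2 @^-1` [set x | 0 <= x]).
Proof. by apply/seteqP; split => z; [move=> [? ? ?]|move=> [? [? ?]]]. Qed.

Lemma closed_ctri : closed ctri.
Proof.
rewrite ctri_setI; apply: closedI; last apply: closedI.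
- by apply: closed_comp => [? _|]; [exact: continuous_bc0|exact: closed_ge].
- by apply: closed_comp => [? _|]; [exact: continuous_bc1|exact: closed_ge].
- by apply: closed_comp => [? _|]; [exact: continuous_bc2|exact: closed_ge].
Qed.

Lemma tri_sub : tri `<=` ctri.
Proof. by move=> z /triE[h0 h1 h2]; split; exact: ltW. Qed.

Lemma cvg_bary (T : Type) (F : set_system T) (FF : Filter F) (f g : T -> R) s t :
  f @ F --> s -> g @ F --> t -> bary (f x) (g x) @[x --> F] --> bary s t.
Proof.
move=> fs gt; apply: cvgD; first exact: cvg_rC.
by apply: cvgM; [exact: cvg_rC|exact: cvg_cst].
Qed.

Lemma closure_tri : closure tri = ctri.
Proof.
apply/seteqP; split.
  by have /closure_subset := tri_sub; rewrite -(closure_id ctri).1 //; exact: closed_ctri.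
move=> z [z0 z1 z2].
(* Points of the open triangle on the segment from z to its centre. *)
pose f (e : R) := bary (bc1 z + e * (1/3 - bc1 z)) (bc2 z + e * (1/3 - bc2 z)).
have fz : f @ 0^'+ --> z.
  rewrite [X in _ --> X](_ : z = f 0); last first.
    by rewrite /f !mul0r !addr0 -baryE.
  apply: cvg_at_right_filter; apply: cvg_bary;
    (apply: cvgD; first exact: cvg_cst); (apply: cvgM; last exact: cvg_cst);
    exact: cvg_id.
move=> B zB.
suff : \forall e \near 0^'+, (tri `&` B) (f e).
  by move=> h; have [e he] := @filter_ex _ _ (at_right_proper_filter 0) _ h; exists (f e).
near=> e; split; last by near: e; exact: fz.
have e0 : 0 < e by near: e; exact: nbhs_right_gt.
have e1 : e < 1 by near: e; apply: nbhs_right_lt.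
by apply/triE; move: z0; rewrite /bc0 !bc1_bary !bc2_bary => z0; split; nra.
Unshelve. all: by end_near. Qed.

(** The rotation by a third of a turn about the centre of the triangle, which
    takes 0 to 1, 1 to omega and omega to 0. *)
Definition rot z : plane R := 1 + omega ^+ 2 * z.

Lemma omega2 : omega ^+ 2 = omega - 1.
Proof.
have h2 := height2; apply: complexP; rewrite expr2 ?(cReM, cImM, cReB, cImB) Re_omega Im_omega /=.
  by rewrite expr2 in h2; lra.
by lra.
Qed.

Lemma rotE z : rot z = bary (bc0 z) (bc1 z).
Proof.
rewrite {1}(baryE z) /rot /bary /bc0 mulrDr.
have -> : omega ^+ 2 * ((bc2 z)%:C * omega) = - (bc2 z)%:C.
  rewrite mulrCA -exprSr expiX -(mulr_natr (pi / 3)) divfK // expi_pi.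
  by rewrite mulrN1.
rewrite omega2 !rmorphB /= rmorph1; ring.
Qed.

Lemma bc0_rot z : bc0 (rot z) = bc2 z.
Proof. by rewrite {1}/bc0 rotE bc1_bary bc2_bary /bc0; ring. Qed.
Lemma bc1_rot z : bc1 (rot z) = bc0 z.
Proof. by rewrite rotE bc1_bary. Qed.
Lemma bc2_rot z : bc2 (rot z) = bc1 z.
Proof. by rewrite rotE bc2_bary. Qed.

Lemma rot_inj : injective rot.
Proof. by move=> z w /addrI/mulfI; apply; rewrite expf_neq0 // expi_neq0. Qed.

Lemma rotK3 z : rot (rot (rot z)) = z.
Proof. by apply: bary_inj; rewrite !(bc0_rot, bc1_rot, bc2_rot). Qed.

End Triangle.

(** * The boundary of the triangle *)

Section BoundaryCurve.
Context {R : realType}.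
Implicit Types (z w : plane R) (x y r s t : R).

(** The projection of the line onto [0, 1]. *)
Definition clamp x : R := (`|x| - `|x - 1| + 1) / 2.

Lemma clamp_le0 x : x <= 0 -> clamp x = 0.
Proof. by move=> h; rewrite /clamp !ler0_norm //; lra. Qed.

Lemma clamp_mid x : 0 <= x -> x <= 1 -> clamp x = x.
Proof. by move=> h1 h2; rewrite /clamp ger0_norm // ler0_norm; lra. Qed.

Lemma clamp_ge1 x : 1 <= x -> clamp x = 1.
Proof. by move=> h; rewrite /clamp !ger0_norm; lra. Qed.

Lemma cvg_clamp (T : Type) (F : set_system T) (FF : Filter F) (f : T -> R) x :
  f @ F --> x -> clamp (f t) @[t --> F] --> clamp x.
Proof.
move=> fx; apply: cvgM; last exact: cvg_cst.
apply: cvgD; last exact: cvg_cst.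
by apply: cvgB; apply: cvg_norm => //; apply: cvgB => //; exact: cvg_cst.
Qed.

(** The boundary of the triangle run counterclockwise from 0. Each clamp is
    active on one third of [0, 1]; a single formula makes continuity plain. *)
Definition tricurve t : plane R :=
  bary (clamp (3 * t) - clamp (3 * t - 1)) (clamp (3 * t - 1) - clamp (3 * t - 2)).

Lemma cvg_tricurve (T : Type) (F : set_system T) (FF : Filter F) (f : T -> R) x :
  f @ F --> x -> tricurve (f t) @[t --> F] --> tricurve x.
Proof.
move=> fx; have h c : clamp (3 * f t - c) @[t --> F] --> clamp (3 * x - c).
  apply: cvg_clamp; apply: cvgB; last exact: cvg_cst.
  by apply: cvgM => //; exact: cvg_cst.
have h3 : clamp (3 * f t) @[t --> F] --> clamp (3 * x).
  by apply: cvg_clamp; apply: cvgM => //; exact: cvg_cst.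
apply: cvg_bary; first exact: (cvgB h3 (h 1)).
exact: (cvgB (h 1) (h 2)).
Qed.

Lemma tricurve_side0 t : 0 <= t -> t <= 1/3 -> tricurve t = bary (3 * t) 0.
Proof.
move=> h1 h2; rewrite /tricurve.
have -> : clamp (3 * t) = 3 * t by apply: clamp_mid; lra.
have -> : clamp (3 * t - 1) = 0 by apply: clamp_le0; lra.
have -> : clamp (3 * t - 2) = 0 by apply: clamp_le0; lra.
by rewrite !subr0.
Qed.

Lemma tricurve_side1 t : 1/3 <= t -> t <= 2/3 -> tricurve t = bary (2 - 3 * t) (3 * t - 1).
Proof.
move=> h1 h2; rewrite /tricurve.
have -> : clamp (3 * t) = 1 by apply: clamp_ge1; lra.
have -> : clamp (3 * t - 1) = 3 * t - 1 by apply: clamp_mid; lra.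
have -> : clamp (3 * t - 2) = 0 by apply: clamp_le0; lra.
by rewrite subr0; congr bary; ring.
Qed.

Lemma tricurve_side2 t : 2/3 <= t -> t <= 1 -> tricurve t = bary 0 (3 - 3 * t).
Proof.
move=> h1 h2; rewrite /tricurve.
have -> : clamp (3 * t) = 1 by apply: clamp_ge1; lra.
have -> : clamp (3 * t - 1) = 1 by apply: clamp_ge1; lra.
have -> : clamp (3 * t - 2) = 3 * t - 2 by apply: clamp_mid; lra.
by congr bary; ring.
Qed.

Lemma sideP t : 0 <= t <= 1 ->
  [\/ 0 <= t /\ t <= 1/3, 1/3 <= t /\ t <= 2/3 | 2/3 <= t /\ t <= 1].
Proof.
move=> /andP[h0 h1]; case: (leP t (1/3)) => h2; first by constructor 1.
by case: (leP t (2/3)) => h3; [constructor 2; split => //; exact: ltW|constructor 3; split => //; exact: ltW].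
Qed.

(** The boundary of the triangle. *)
Definition bdtri : set (plane R) := ctri `\` tri.

Lemma bdtriE z : bdtri z <->
  ctri z /\ [\/ bc0 z = 0, bc1 z = 0 | bc2 z = 0].
Proof.
split; last first.
  move=> [hz h]; split=> // /triE[h0 h1 h2].
  by case: h => h; rewrite h ltxx in h0 h1 h2.
move=> [hz nz]; split => //; case: hz => h0 h1 h2.
have [?|n0] := eqVneq (bc0 z) 0; first by constructor 1.
have [?|n1] := eqVneq (bc1 z) 0; first by constructor 2.
have [?|n2] := eqVneq (bc2 z) 0; first by constructor 3.
by case: nz; apply/triE; rewrite !lt0r n0 n1 n2.
Qed.

Lemma tricurve_image : tricurve @` `[0, 1] = bdtri.
Proof.
apply/seteqP; split => [_ [t + <-]|z].
  rewrite /= in_itv /= => /sideP[][h1 h2]; apply/bdtriE.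
  - rewrite tricurve_side0 // /ctri /bc0 /= bc1_bary bc2_bary.
    by split; [split; lra|constructor 3].
  - rewrite tricurve_side1 // /ctri /bc0 /= bc1_bary bc2_bary.
    by split; [split; lra|constructor 1; lra].
  - rewrite tricurve_side2 // /ctri /bc0 /= bc1_bary bc2_bary.
    by split; [split; lra|constructor 2].
move=> /bdtriE[[]]; rewrite /bc0 => h0 h1 h2 [h|h|h].
- exists (2/3 - bc1 z / 3); first by rewrite /= in_itv /=; apply/andP; split; lra.
  rewrite tricurve_side1; [|lra|lra].
  by rewrite [RHS]baryE; congr bary; lra.
- exists (1 - bc2 z / 3); first by rewrite /= in_itv /=; apply/andP; split; lra.
  rewrite tricurve_side2; [|lra|lra].
  by rewrite [RHS]baryE; congr bary; lra.
- exists (bc1 z / 3); first by rewrite /= in_itv /=; apply/andP; split; lra.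
  rewrite tricurve_side0; [|lra|lra].
  by rewrite [RHS]baryE; congr bary; lra.
Qed.

Lemma tricurve_inj : {in `[0, 1[ &, injective tricurve}.
Proof.
move=> t t'; rewrite !in_itv /= => /andP[a1 a2] /andP[c1 c2] h.
have : bc1 (tricurve t) = bc1 (tricurve t') by rewrite h.
have : bc2 (tricurve t) = bc2 (tricurve t') by rewrite h.
have /sideP : 0 <= t <= 1 by rewrite a1 ltW.
have /sideP : 0 <= t' <= 1 by rewrite c1 ltW.
move=> {h} [][h1 h2] [][h3 h4];
  rewrite ?(tricurve_side0 h1 h2) ?(tricurve_side1 h1 h2) ?(tricurve_side2 h1 h2)
   ?(tricurve_side0 h3 h4) ?(tricurve_side1 h3 h4) ?(tricurve_side2 h3 h4) !bc1_bary !bc2_bary; lra.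
Qed.

Lemma tricurve0 : tricurve 0 = 0.
Proof.
by rewrite tricurve_side0; [rewrite mulr0 /bary mul0r addr0|lra|lra].
Qed.

Lemma tricurve1 : tricurve 1 = 0.
Proof.
rewrite tricurve_side2; [|lra|lra].
by rewrite mulr1 subrr /bary mul0r addr0.
Qed.

Lemma rot_bdtri z : bdtri z -> bdtri (rot z).
Proof.
move=> /bdtriE[[h0 h1 h2] h]; apply/bdtriE; rewrite /ctri /= !(bc0_rot, bc1_rot, bc2_rot).
by split => //; case: h => h; [constructor 2|constructor 3|constructor 1].
Qed.

(** Rotated, [tricurve] runs along the same boundary, starting from 1. *)
Lemma rot_tricurve_image : (rot \o tricurve) @` `[0, 1] = bdtri.
Proof.
rewrite -image_comp tricurve_image; apply/seteqP; split => [_ [z hz <-]|z hz].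
  exact: rot_bdtri.
exists (rot (rot z)); last exact: rotK3.
by do 2!apply: rot_bdtri.
Qed.

End BoundaryCurve.

(** * Winding numbers *)

Section Winding.
Context {R : realType}.
Implicit Types (z w : plane R) (x y r s t : R) (g : R -> plane R).

Lemma polar_exists z : exists a, z = (cmod z)%:C * expi a.
Proof.
have [p0|p0] := ltP 0 (cmod z + Re z); first by exists (Arg z); exact: Arg_polarE.
exists pi; rewrite expi_pi.
have h1 := Re_le_cmod z; have h2 := cmodE2 z.
have hr : Re z = - cmod z.
  by move: h1; rewrite ler_norml => /andP[h _]; apply: le_anti; apply/andP; split; lra.
have hi : Im z = 0.
  by apply/eqP; rewrite -sqrf_eq0; apply/eqP; move: h2; rewrite hr sqrrN; lra.
by apply: complexP; rewrite ?(cReM, cImM) /= ?hr ?hi; ring.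
Qed.

(** The numbers off the closed negative real half-line are those with positive
    [cmod z + Re z], the denominator of [Arg]. *)
Lemma slitP z : (forall x, x <= 0 -> z != x%:C) -> 0 < cmod z + Re z.
Proof.
move=> h; rewrite ltNge; apply/negP => p0.
have h1 := Re_le_cmod z; have h2 := cmodE2 z; have h0 := cmod_ge0 z.
have hr : Re z = - cmod z.
  by move: h1; rewrite ler_norml => /andP[k _]; apply: le_anti; apply/andP; split; lra.
have hi : Im z = 0.
  by apply/eqP; rewrite -sqrf_eq0; apply/eqP; move: h2; rewrite hr sqrrN; lra.
have /negP[] := h (Re z) ltac:(lra).
by apply/eqP; apply: complexP.
Qed.

(** The quotient of the two displacement vectors stays, up to a constant
    factor, off the closed negative real half-line, where the principal
    argument is continuous. *)
Lemma winds_mul g g' z z' (q : R -> plane R) (c : plane R) n :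
  c != 0 -> {within `[0, 1], continuous q} -> q 0 = q 1 ->
  (forall t, 0 <= t <= 1 -> 0 < cmod (q t) + Re (q t)) ->
  (forall t, 0 <= t <= 1 -> g' t - z' = c * q t * (g t - z)) ->
  winds g z n -> winds g' z' n.
Proof.
move=> c0 qC q01 slit gE [th [thC thE th01]].
have [a ca] := polar_exists c.
exists (fun t => th t + Arg (q t) + a); split.
- move/subspace_continuousP: thC => thC; move/subspace_continuousP: qC => qC.
  apply/subspace_continuousP => t t01.
  apply: cvgD; last exact: cvg_cst.
  apply: cvgD; first exact: thC.
  by apply: cvg_Arg; [apply: slit; rewrite /= in_itv in t01|exact: qC].
- move=> t t01; rewrite gE // {1}(thE _ t01) !normE.
  have {1}-> := Arg_polarE (slit _ t01).
  rewrite {1}ca !cmodM !expiD !rmorphM /=; ring.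
- by rewrite q01 -th01; ring.
Qed.

(** The unit circle, started in the direction from the centre of the triangle
    to the vertex 0. *)
Definition circle t : plane R := expi (2 * pi * t - pi / 2 - pi / 3).

Lemma winds_circle : winds circle 0 1.
Proof.
exists (fun t => 2 * pi * t - pi / 2 - pi / 3); split.
- apply: continuous_subspaceT => t.
  apply: cvgB; last exact: cvg_cst.
  apply: cvgB; last exact: cvg_cst.
  by apply: cvgM; [exact: cvg_cst|exact: cvg_id].
- by move=> t _; rewrite subr0 normE cmod_expi mul1r.
- by rewrite mulr0 mulr1; ring.
Qed.

Lemma bc2_circle t : 0 <= t -> t <= 1/3 -> bc2 (circle t) < 0.
Proof.
move=> h1 h2; have pi0 := pi_gt0 R; rewrite /bc2 /circle /= pmulr_llt0 ?invr_gt0 ?height_gt0 //.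
have : 0 < sin (2 * pi * (1/3 - t) + pi/6 : R).
  by apply: sin_gt0_pi; apply/andP; split; nra.
rewrite -oppr_lt0 -sinN.
have -> // : - (2 * pi * (1/3 - t) + pi/6) = 2 * pi * t - pi / 2 - pi / 3 :> R by field.
Qed.

Lemma bc1B z w : bc1 (z - w) = bc1 z - bc1 w.
Proof. by rewrite /bc1 cReB cImB; ring. Qed.
Lemma bc2B z w : bc2 (z - w) = bc2 z - bc2 w.
Proof. by rewrite /bc2 cImB; ring. Qed.
Lemma bc1Z x z : bc1 (x%:C * z) = x * bc1 z.
Proof. by rewrite /bc1 cReM cImM /=; ring. Qed.
Lemma bc2Z x z : bc2 (x%:C * z) = x * bc2 z.
Proof. by rewrite /bc2 cImM /=; ring. Qed.

Lemma bc1_omega2 z : bc1 (omega ^+ 2 * z) = - (bc1 z + bc2 z).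
Proof.
have -> : omega ^+ 2 * z = rot z - rot 0 by rewrite /rot; ring.
by rewrite bc1B !bc1_rot /bc0 /bc1 /bc2 /=; ring.
Qed.

Lemma bc2_omega2 z : bc2 (omega ^+ 2 * z) = bc1 z.
Proof.
have -> : omega ^+ 2 * z = rot z - rot 0 by rewrite /rot; ring.
by rewrite bc2B !bc2_rot /bc1 /=; ring.
Qed.

Lemma circle_omega2 t : circle t = omega ^+ 2 * circle (t - 1/3).
Proof.
by rewrite /circle expiX -expiD; congr expi; rewrite -(mulr_natr (pi / 3)); field.
Qed.

(** For each of the three sides, the linear form that cuts it out takes values
    of the same strict sign on [tricurve t - w] and on [circle t] while t
    describes the side; hence their quotient is never a negative real number. *)
Lemma winds_tricurve w : tri w -> winds tricurve w 1.
Proof.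
move=> /triE[w0 w1 w2].
have circn0 t : circle t != 0 by exact: expi_neq0.
apply: (@winds_mul circle tricurve 0 w (fun t => (tricurve t - w) / circle t) 1 1 (oner_neq0 _)).
- apply: continuous_subspaceT => t.
  apply: cvgM.
    by apply: cvgB; [apply: cvg_tricurve; exact: cvg_id|exact: cvg_cst].
  apply: cvgV => //; apply: cvg_expi.
  apply: cvgB; last exact: cvg_cst.
  apply: cvgB; last exact: cvg_cst.
  by apply: cvgM; [exact: cvg_cst|exact: cvg_id].
- rewrite tricurve0 tricurve1; congr (_ / _).
  rewrite /circle; have <- : 2 * pi * 0 - pi / 2 - pi / 3 + pi *+ 2 = 2 * pi * 1 - pi / 2 - pi / 3 :> R.
    by rewrite -(mulr_natr pi); ring.
  by rewrite /expi cosD2pi sinD2pi.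
- move=> t /sideP t01; apply: slitP => x x0; apply/negP => /eqP qx.
  have {qx} gE : tricurve t - w = x%:C * circle t by rewrite -qx divfK.
  have h1 : bc1 (tricurve t) - bc1 w = x * bc1 (circle t) by rewrite -bc1B gE bc1Z.
  have h2 : bc2 (tricurve t) - bc2 w = x * bc2 (circle t) by rewrite -bc2B gE bc2Z.
  move: w0; rewrite /bc0 => w0.
  case: t01 => -[t0 t1].
  + move: h1 h2; rewrite tricurve_side0 // bc1_bary bc2_bary => _ h2.
    have := bc2_circle t0 t1; nra.
  + move: h1 h2; rewrite tricurve_side1 // bc1_bary bc2_bary circle_omega2 bc1_omega2 bc2_omega2.
    have : bc2 (circle (t - 1/3)) < 0 by apply: bc2_circle; lra.
    nra.
  + move: h1 h2; rewrite tricurve_side2 // bc1_bary bc2_bary circle_omega2 circle_omega2 !bc1_omega2 !bc2_omega2.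
    have : bc2 (circle (t - 1/3 - 1/3)) < 0 by apply: bc2_circle; lra.
    nra.
- by move=> t _; rewrite mul1r subr0 divfK.
- exact: winds_circle.
Qed.

Lemma winds_rot_tricurve w : tri w -> winds (rot \o tricurve) w 1.
Proof.
move=> /triE[w0 w1 w2].
have : tri (rot (rot w)) by apply/triE; rewrite !(bc0_rot, bc1_rot, bc2_rot).
move=> /winds_tricurve.
apply: (@winds_mul _ _ _ _ (fun=> 1) (omega ^+ 2)).
- by rewrite expf_neq0 // expi_neq0.
- by apply: continuous_subspaceT => t; exact: cvg_cst.
- by [].
- by move=> t _; rewrite /cmod /= expr0n expr1n addr0 sqrtr1; lra.
- by move=> t _; rewrite mulr1 -{1}(rotK3 w) /= /rot; ring.
Qed.

End Winding.

(** * Power maps of the triangle onto sectors *)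

Section SectorMap.
Context {R : realType}.
Implicit Types (z w u v : plane R) (x y r s t a : R).

(** The closed first quadrant. *)
Definition quadrant : set (plane R) := [set z | 0 <= Re z /\ 0 <= Im z].

Lemma quadrant_expi r a : 0 <= r -> 0 <= a -> a <= pi / 2 ->
  quadrant (r%:C * expi a).
Proof.
move=> r0 a0 a1; have pi0 := pi_gt0 R.
split; rewrite ?cReM ?cImM /= mul0r ?subr0 ?addr0 mulr_ge0 //.
  by apply: cos_ge0_pihalf; apply/andP; split => //; lra.
by apply: sin_ge0_pi; apply/andP; split => //; lra.
Qed.

Lemma Re_expi_gt0 r a : 0 < r -> 0 <= a -> a < pi / 2 -> 0 < Re (r%:C * expi a).
Proof.
move=> r0 a0 a1; have pi0 := pi_gt0 R.
rewrite cReM /= mul0r subr0 mulr_gt0 //.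
by apply: cos_gt0_pihalf; apply/andP; split => //; lra.
Qed.

Lemma polarX r a k : (r%:C * expi a) ^+ k = (r ^+ k)%:C * expi (a *+ k) :> plane R.
Proof. by rewrite exprMn expiX -rmorphXn. Qed.

Lemma polarM r a s t : r%:C * expi a * (s%:C * expi t) = (r * s)%:C * expi (a + t) :> plane R.
Proof. by rewrite expiD rmorphM; ring. Qed.

(** The quotient of u^k - v^k by u - v. *)
Definition qsum k u v : plane R := \sum_(i < k) u ^+ (k.-1 - i) * v ^+ i.

Lemma qsumE k u v : u ^+ k - v ^+ k = (u - v) * qsum k u v.
Proof. by rewrite subrXX. Qed.

(** Every term of [qsum] has its argument in [0, pi/2[, and one of them is not 0. *)
Lemma qsum_quadrant k r a s t A : (0 < k)%N -> 0 <= r -> 0 < s ->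
  0 <= a <= A -> 0 <= t <= A -> A *+ k.-1 < pi / 2 ->
  let q := qsum k (r%:C * expi a) (s%:C * expi t) in 0 < Re q /\ 0 <= Im q.
Proof.
case: k => // k _ r0 s0 /andP[a0 aA] /andP[t0 tA] /= Ak.
have A0 : 0 <= A by lra.
rewrite /qsum /= big_ord_recr /= subnn expr0 mul1r cReD cImD polarX.
have tk : t *+ k < pi / 2 by apply: le_lt_trans Ak; rewrite lerMn2r tA orbT.
have t0k : 0 <= t *+ k by rewrite mulrn_wge0.
have h1 : 0 < Re ((s ^+ k)%:C * expi (t *+ k) : plane R).
  by apply: Re_expi_gt0 => //; exact: exprn_gt0.
have [_ h2] : quadrant ((s ^+ k)%:C * expi (t *+ k) : plane R).
  by apply: quadrant_expi => //; [exact/exprn_ge0/ltW|exact: ltW].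
set S := \sum_(i < k) _.
suff [h3 h4] : quadrant S by split; [exact: ltr_wpDl|exact: addr_ge0].
rewrite /S; apply: (big_ind quadrant) => [|x y [x0 x1] [y0 y1]|i _].
- by split.
- by split; rewrite ?cReD ?cImD addr_ge0.
rewrite !polarX polarM; apply: quadrant_expi.
- by rewrite mulr_ge0 // exprn_ge0 // ltW.
- by rewrite addr_ge0 // mulrn_wge0.
- have -> : pi / 2 = A *+ k + (pi / 2 - A *+ k) by ring.
  apply: (@le_trans _ _ (A *+ k)); last by rewrite lerDl subr_ge0 ltW.
  have -> : A *+ k = A *+ (k - i) + A *+ i.
    by rewrite -mulrnDr subnK // ltnW.
  by rewrite lerD // lerMn2r ?aA ?tA orbT.
Qed.

Lemma Arg_pihalf z : 0 < Re z -> `|Arg z| < pi / 2.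
Proof.
move=> z0; have pi0 := pi_gt0 R; have zE := Arg_polarE (Re_gt0_slit z0).
have : 0 < cos `|Arg z|.
  move: z0; rewrite {1}zE cReM /= mul0r subr0 cos_norm.
  by move=> h; have := cmod_ge0 z; nra.
have := Arg_bound z; move: `|Arg z| => a api ca; rewrite ltNge; apply/negP => ha.
have : 0 <= sin (a - pi / 2) by apply: sin_ge0_pi; apply/andP; split; lra.
by rewrite sinBpihalf; lra.
Qed.

Lemma sin_ge0_arg t : `|t| < pi -> 0 <= sin t -> 0 <= t.
Proof.
move=> tpi st; rewrite leNgt; apply/negP => t0.
have : 0 < sin (- t).
  by apply: sin_gt0_pi; move: tpi; rewrite ltr_norml => /andP[? ?]; apply/andP; split; lra.
by rewrite sinN; lra.
Qed.

Lemma ctri_Re w : ctri w -> 0 <= Re w.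
Proof.
by move=> [_ h1 h2]; rewrite (baryE w) /bary cReD cReM Re_omega Im_omega /=; nra.
Qed.

Lemma tri_Re w : tri w -> 0 < Re w.
Proof.
by move=> /triE[_ h1 h2]; rewrite (baryE w) /bary cReD cReM Re_omega Im_omega /=; nra.
Qed.

Lemma ctri_cmod w : ctri w -> cmod w <= 1.
Proof.
move=> [h0 h1 h2]; rewrite (baryE w) /bary.
apply: le_trans (cmodD _ _) _; rewrite cmodM cmod_expi !cmod_real !ger0_norm //.
by move: h0; rewrite /bc0; lra.
Qed.

Lemma ctri_arg w : ctri w -> w != 0 -> 0 <= Arg w <= pi / 3.
Proof.
move=> Tw w0; have pi0 := pi_gt0 R; have Rw := ctri_Re Tw.
have cw : 0 < cmod w by rewrite cmod_gt0.
have wE : w = (cmod w)%:C * expi (Arg w) by apply: Arg_polarE; rewrite ltr_pwDl.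
have Aw := Arg_bound w; case: Tw => _ h1 h2.
have A0 : 0 <= Arg w.
  apply: sin_ge0_arg => //; have : 0 <= Im w.
    by move: h2; rewrite /bc2 pmulr_lge0 // invr_gt0 height_gt0.
  by rewrite {1}wE cImM /= mul0r addr0 pmulr_rge0.
rewrite A0 /= -subr_ge0; apply: sin_ge0_arg.
  by move: Aw; rewrite !ltr_norml => /andP[? ?]; apply/andP; split; lra.
rewrite sinB cos_pi3 -/height -(pmulr_rge0 _ cw).
have -> : cmod w * (height * cos (Arg w) - 2^-1 * sin (Arg w)) = height * Re w - Im w / 2.
  have -> : Re w = cmod w * cos (Arg w) by rewrite {1}wE cReM /= mul0r subr0.
  have -> : Im w = cmod w * sin (Arg w) by rewrite {1}wE cImM /= mul0r addr0.
  by field.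
have -> : height * Re w - Im w / 2 = height * bc1 w by rewrite /bc1; field; rewrite gt_eqF // height_gt0.
by rewrite mulr_ge0 // ltW // height_gt0.
Qed.

Section Maps.
Context (n m : nat) (ze : plane R).
Context (n_gt0 : (0 < n)%N) (n_le_m : (n <= m)%N) (m_lt : (2 * m < 3 * n)%N).
Context (ze_neq0 : ze != 0).

Let m_gt0 : (0 < m)%N. Proof. exact: leq_trans n_gt0 n_le_m. Qed.

(** The map w |-> ze w^(m/n), its inverse, and the image of the open triangle:
    a curvilinear triangle with angle m pi / 3n at the vertex 0. The bounds on
    m and n keep that sector inside the right half-plane, up to the factor ze.
    Both maps are continuous on the whole plane. *)
Definition secmap w : plane R := ze * croot n w ^+ m.
Definition secinv z : plane R := croot m (z / ze) ^+ n.
Definition secdom : set (plane R) := secmap @` tri.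

(** A point of the closed triangle is the n-th power of a point of argument at
    most pi / 3n, which is its [croot]. *)
Lemma ctri_polar w : ctri w -> exists r a,
  [/\ 0 <= r, (w != 0 -> 0 < r), 0 <= a <= pi / 3 / n%:R &
      w = (r%:C * expi a) ^+ n] /\ croot n w = r%:C * expi a.
Proof.
move=> Tw; have pi0 := pi_gt0 R; have n0 : 0 < n%:R :> R by rewrite ltr0n.
suff [r [a [r0 rw aA wE]]] : exists r a, [/\ 0 <= r, (w != 0 -> 0 < r),
  0 <= a <= pi / 3 / n%:R & w = (r%:C * expi a) ^+ n].
  exists r, a; split => //; rewrite {1}wE croot_polar //.
  case/andP: aA => a0; rewrite ler_pdivlMr // mulr_natr => a1.
  by rewrite ger0_norm ?mulrn_wge0 //; lra.
have [->|w0] := eqVneq w 0.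
  exists 0, 0; split => //; last by rewrite mul0r expr0n eqn0Ngt n_gt0.
  by rewrite lexx /= ltW // !divr_gt0.
exists (rroot n (cmod w)), (Arg w / n%:R).
have cw : 0 < cmod w by rewrite cmod_gt0.
split.
- exact: rroot_ge0.
- by move=> _; apply: powR_gt0.
- have /andP[A0 A1] := ctri_arg Tw w0.
  by rewrite divr_ge0 ?(ltW n0) //= ler_pM2r // invr_gt0.
- rewrite polarX rrootK ?(ltW cw) // -(mulr_natr (_ / _)) divfK ?gt_eqF //.
  by apply: Arg_polarE; rewrite ltr_pwDl // ctri_Re.
Qed.

Lemma angle_bound a k : 0 <= a <= pi / 3 / n%:R -> (k <= m)%N -> a *+ k < pi / 2.
Proof.
move=> /andP[a0 a1] km; have pi0 := pi_gt0 R; have n0 : 0 < n%:R :> R by rewrite ltr0n.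
apply: (@le_lt_trans _ _ (pi / 3 / n%:R * k%:R)).
  by rewrite -(mulr_natr a) ler_wpM2r.
have kn : (2 * k%:R < 3 * n%:R :> R).
  by rewrite -!natrM ltr_nat (leq_ltn_trans _ m_lt) // leq_mul2l.
rewrite mulrAC ltr_pdivrMr //; nra.
Qed.

Lemma secmapK w : ctri w -> secinv (secmap w) = w.
Proof.
move=> /ctri_polar[r [a [[r0 _ aA wE] uE]]].
rewrite /secinv /secmap mulrC mulKf // uE croot_polar //.
case/andP: (aA) => a0 _; rewrite ger0_norm ?mulrn_wge0 //; apply/ltW.
exact: angle_bound.
Qed.

Lemma secmap_Re w : tri w -> 0 < Re (secmap w / ze).
Proof.
move=> Tw; have [r [a [[r0 rp aA wE] uE]]] := ctri_polar (tri_sub Tw).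
rewrite /secmap mulrC mulKf // uE polarX.
case/andP: (aA) => a0 _; apply: Re_expi_gt0; rewrite ?mulrn_wge0 ?angle_bound //.
apply: exprn_gt0; apply: rp; apply/eqP => w0.
by have := tri_Re Tw; rewrite w0 ltxx.
Qed.

Lemma secinvK z : 0 < Re (z / ze) -> secmap (secinv z) = z.
Proof.
move=> z0; rewrite /secmap /secinv.
have -> : croot n (croot m (z / ze) ^+ n) = croot m (z / ze).
  have [A uE AE] : exists2 A, croot m (z / ze) = (rroot m (cmod (z / ze)))%:C * expi A &
      A = Arg (`|Re (z / ze)| +i* Im (z / ze)) / m%:R.
    by exists (Arg (`|Re (z / ze)| +i* Im (z / ze)) / m%:R).
  rewrite uE croot_polar ?rroot_ge0 //.
  have {}AE : `|A| < pi / 2 / m%:R.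
    rewrite AE normrM normfV normr_nat ltr_pM2r ?invr_gt0 ?ltr0n //.
    by apply: Arg_pihalf; rewrite /= normr_gt0 gt_eqF.
  rewrite -(mulr_natr A) normrM normr_nat; apply: le_trans (_ : pi / 2 / m%:R * n%:R <= _).
    by rewrite ler_wpM2r // ltW.
  rewrite mulrAC ler_pdivrMr ?ltr0n // ler_wpM2l ?ler_nat //.
  by rewrite divr_ge0 ?pi_ge0.
by rewrite crootK ?(ltW z0) // mulrC divfK.
Qed.

Lemma secdomE z : secdom z <-> 0 < Re (z / ze) /\ tri (secinv z).
Proof.
split; last by move=> [h1 h2]; exists (secinv z) => //; exact: secinvK.
by move=> [w Tw <-]; rewrite secmapK; [split => //; exact: secmap_Re|exact: tri_sub].
Qed.

Lemma cvg_secmap (T : Type) (F : set_system T) (FF : Filter F) (f : T -> plane R) z :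
  f @ F --> z -> secmap (f i) @[i --> F] --> secmap z.
Proof.
move=> fz; apply: (cvg_mul FF); first exact: cvg_cst.
exact: (cvg_expn FF (cvg_croot n_gt0 FF fz)).
Qed.

Lemma cvg_secinv (T : Type) (F : set_system T) (FF : Filter F) (f : T -> plane R) z :
  f @ F --> z -> secinv (f i) @[i --> F] --> secinv z.
Proof.
move=> fz; have h : f i / ze @[i --> F] --> z / ze.
  exact: (cvg_mul FF fz (cvg_cst _)).
exact: (cvg_expn FF (cvg_croot m_gt0 FF h)).
Qed.

Lemma continuous_secmap : continuous secmap.
Proof. by move=> z; exact: (cvg_secmap (nbhs_filter z) (@cvg_id _ _)). Qed.
Lemma continuous_secinv : continuous secinv.
Proof. by move=> z; exact: (cvg_secinv (nbhs_filter z) (@cvg_id _ _)). Qed.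

Lemma open_secdom : open secdom.
Proof.
have -> : secdom = (fun z => Re (z / ze)) @^-1` [set x | 0 < x] `&` secinv @^-1` tri.
  by apply/seteqP; split => z /secdomE.
apply: openI; last first.
  by apply: open_comp; [move=> z _; exact: continuous_secinv|exact: open_tri].
apply: open_comp; last exact: open_gt.
move=> z _; apply: (cvg_Re (nbhs_filter z)); apply: (@cvgM _ _ _ (nbhs_filter z)).
  exact: cvg_id.
exact: cvg_cst.
Qed.

Lemma closure_secdom : closure secdom = secmap @` ctri.
Proof.
apply/seteqP; split; last first.
  move=> _ [w + <-]; rewrite -closure_tri => wT B zB.
  have [v [vT vB]] := wT _ (continuous_secmap zB).
  by exists (secmap v); split => //; exists v.
(* S is closed, since both maps are continuous everywhere. *)
pose S := secinv @^-1` ctri `&` (fun z => cmod (secmap (secinv z) - z)) @^-1` [set x | x <= 0].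
have sub : secdom `<=` S.
  move=> z /secdomE[h1 h2]; split; first exact: tri_sub.
  by rewrite /= secinvK // subrr cmod0.
have cS : closed S.
  apply: closedI.
    by apply: closed_comp => [z _|]; [exact: continuous_secinv|exact: closed_ctri].
  apply: closed_comp => [z _|]; last exact: closed_le.
  apply: (cvg_cmod (nbhs_filter z)); apply: (@cvgB _ _ _ _ (nbhs_filter z)).
    apply: (cvg_secmap (nbhs_filter z)); exact: continuous_secinv.
  exact: cvg_id.
move/closure_subset: sub; rewrite -(closure_id S).1 //.
move=> sub z /sub[h1 h2]; exists (secinv z) => //.
by apply/eqP; rewrite -subr_eq0 -cmod_eq0 eq_le h2 cmod_ge0.
Qed.

Lemma secmap_inj w w' : ctri w -> ctri w' -> secmap w = secmap w' -> w = w'.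
Proof. by move=> h h' e; rewrite -(secmapK h) e secmapK. Qed.

Lemma boundary_secdom : boundary secdom = secmap @` bdtri.
Proof.
rewrite /boundary closure_secdom (interior_id _).1; last exact: open_secdom.
apply/seteqP; split => [_ [[w Tw <-] h]|_ [w [Tw nT] <-]].
  by exists w => //; split => // Tw'; apply: h; exists w.
split; first by exists w.
move=> [v Tv /secmap_inj vw]; apply: nT; rewrite -vw //; exact: tri_sub.
Qed.

End Maps.
End SectorMap.

(** * Boundary curve and conformal map of a sector *)

Section SectorDomain.
Context {R : realType}.
Implicit Types (z w u v : plane R) (x y r s t a : R).
Context (n m : nat) (ze : plane R).
Context (n_gt0 : (0 < n)%N) (n_le_m : (n <= m)%N) (m_lt : (2 * m < 3 * n)%N).
Context (ze_neq0 : ze != 0).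

Let m_gt0 : (0 < m)%N. Proof. exact: leq_trans n_gt0 n_le_m. Qed.

Local Notation f := (secmap n m ze).
Local Notation phi := (secinv n m ze).
Local Notation D := (secdom n m ze).

Lemma cvg_psum (T : Type) (F : set_system T) (FF : Filter F) (I : Type)
    (l : seq I) (g : I -> T -> plane R) (w : I -> plane R) :
  (forall j, g j @ F --> w j) ->
  \sum_(j <- l) g j i @[i --> F] --> \sum_(j <- l) w j.
Proof.
move=> gw; elim: l => [|j l IHl].
  rewrite big_nil (_ : (fun i => _) = (fun=> 0)); first exact: cvg_cst.
  by apply/funext => i; rewrite big_nil.
rewrite big_cons (_ : (fun i => _) = (fun i => g j i + \sum_(j <- l) g j i)).
  exact: (cvg_add FF (gw j) IHl).
by apply/funext => i; rewrite big_cons.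
Qed.

Lemma cvg_qsum (T : Type) (F : set_system T) (FF : Filter F)
    (g : T -> plane R) k u v :
  g @ F --> u -> qsum k (g i) v @[i --> F] --> qsum k u v.
Proof.
move=> gu; rewrite /qsum.
apply: (@cvg_psum T F FF 'I_k (index_enum _)
  (fun (j : 'I_k) i => g i ^+ (k.-1 - j) * v ^+ j)
  (fun j : 'I_k => u ^+ (k.-1 - j) * v ^+ j)) => j.
exact: (cvg_mul FF (cvg_expn (k := (k.-1 - j)%N) FF gu) (cvg_cst (v ^+ j))).
Qed.

Lemma qsum_sector k w w0 : (0 < k)%N -> (k <= m)%N -> ctri w -> tri w0 ->
  let q := qsum k (croot n w) (croot n w0) in 0 < Re q /\ 0 <= Im q.
Proof.
move=> k0 km Tw Tw0.
have [r [a [[r0 _ aA _] ->]]] := ctri_polar n_gt0 Tw.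
have [s [t [[_ s0 tA _] ->]]] := ctri_polar n_gt0 (tri_sub Tw0).
apply: (qsum_quadrant (A := pi / 3 / n%:R)) => //.
- apply: s0; apply/eqP => w00; by have := tri_Re Tw0; rewrite w00 ltxx.
- apply: (angle_bound n_gt0 m_lt); last by rewrite -ltnS prednK // ltnW.
  by rewrite lexx andbT !divr_ge0 // pi_ge0.
Qed.

(** With u = w^(1/n), the quotient of the displacements after and before the
    map is ze (u^m - u0^m) / (u^n - u0^n). Up to ze, this is a quotient of two
    numbers of the quadrant with positive real parts, so its real part is
    positive. *)
Lemma winds_secmap (g : R -> plane R) w0 : {within `[0, 1], continuous g} -> g 0 = g 1 ->
  (forall t, 0 <= t <= 1 -> ctri (g t)) -> tri w0 ->
  winds g w0 1 -> winds (f \o g) (f w0) 1.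
Proof.
move=> gC g01 gT Tw0.
pose S k t := qsum k (croot n (g t)) (croot n w0).
have Sn0 t : 0 <= t <= 1 -> S n t != 0.
  move=> t01; have [+ _] := qsum_sector n_gt0 n_le_m (gT _ t01) Tw0.
  by apply: contraTneq; rewrite /S => ->; rewrite ltxx.
have cS k : {within `[0, 1], continuous (S k)}.
  move/subspace_continuousP: gC => gC; apply/subspace_continuousP => t t01.
  apply: cvg_qsum; apply: (cvg_croot n_gt0); exact: gC.
pose q t := S m t / S n t.
move=> gw; apply: (@winds_mul R g (f \o g) w0 (f w0) q ze 1 ze_neq0 _ _ _ _ gw).
- move/subspace_continuousP: (cS m) => cm; move/subspace_continuousP: (cS n) => cn.
  apply/subspace_continuousP => t t01; apply: cvg_mul; first exact: cm.
  by apply: cvgV; [apply: Sn0; rewrite /= in_itv in t01|exact: cn].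
- by rewrite /q /S g01.
- move=> t t01; apply: Re_gt0_slit; rewrite /q.
  have := qsum_sector m_gt0 (leqnn m) (gT _ t01) Tw0.
  have := qsum_sector n_gt0 n_le_m (gT _ t01) Tw0.
  rewrite -/(S m t) -/(S n t) cReM.
  case: (S m t) => a b; case: (S n t) => c d /= [c0 d0] [a0 b0].
  have h : 0 < c ^+ 2 + d ^+ 2 by rewrite ltr_pwDl ?exprn_gt0 ?sqr_ge0.
  rewrite mulrN opprK !mulrA -mulrDl divr_gt0 //; nra.
- move=> t t01; rewrite /= /secmap -mulrBr qsumE -/(S m t) /q -mulrA; congr (_ * _).
  have -> : g t - w0 = (croot n (g t) - croot n w0) * S n t.
    rewrite /S -qsumE !(crootK n_gt0) //; first by exact: ltW (tri_Re _).
    exact: ctri_Re (gT _ t01).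
  by rewrite [RHS]mulrCA divfK ?Sn0.
Qed.

Lemma secmap_jordan (g : R -> plane R) : {within `[0, 1], continuous g} -> g 0 = g 1 ->
  {in `[0, 1[ &, injective g} -> g @` `[0, 1] = bdtri ->
  jordan_param (f \o g) (boundary D).
Proof.
move=> gC g01 ginj gim; split.
- move/subspace_continuousP: gC => gC; apply/subspace_continuousP => t t01.
  by apply: (cvg_secmap n_gt0); exact: gC.
- by rewrite /= g01.
- have gT t : t \in `[0, 1[ -> ctri (g t).
    rewrite in_itv /= => /andP[t0 t1].
    have : bdtri (g t) by rewrite -gim; exists t => //=; rewrite in_itv /= t0 ltW.
    by case.
  move=> s t s01 t01 /(secmap_inj n_gt0 n_le_m m_lt ze_neq0) h.
  by apply: ginj => //; apply: h; exact: gT.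
- by rewrite (boundary_secdom n_gt0 n_le_m m_lt ze_neq0) -gim -image_comp.
Qed.

Lemma secmap_ccw (g : R -> plane R) : {within `[0, 1], continuous g} -> g 0 = g 1 ->
  {in `[0, 1[ &, injective g} -> g @` `[0, 1] = bdtri ->
  (forall w, tri w -> winds g w 1) -> ccw_param D (f \o g).
Proof.
move=> gC g01 ginj gim gw; split; first exact: secmap_jordan.
move=> _ [w Tw <-]; apply: winds_secmap => //; last exact: gw.
move=> t t01; have : bdtri (g t) by rewrite -gim; exists t => //=; rewrite in_itv.
by case.
Qed.

(** The boundary of the sector, run counterclockwise from the image of 0
    ([curveA]) and from the image of 1 ([curveB]). *)
Definition curveA : R -> plane R := f \o tricurve.
Definition curveB : R -> plane R := f \o (rot \o tricurve).

Lemma ccwA : ccw_param D curveA.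
Proof.
apply: secmap_ccw.
- by apply: continuous_subspaceT => t; apply: cvg_tricurve; exact: cvg_id.
- by rewrite tricurve0 tricurve1.
- exact: tricurve_inj.
- exact: tricurve_image.
- by move=> w; exact: winds_tricurve.
Qed.

Lemma ccwB : ccw_param D curveB.
Proof.
apply: secmap_ccw.
- apply: continuous_subspaceT => t; apply: cvgD; first exact: cvg_cst.
  apply: cvg_mul; first exact: cvg_cst.
  by apply: cvg_tricurve; exact: cvg_id.
- by rewrite /= tricurve0 tricurve1.
- by move=> s t s01 t01 /rot_inj; exact: tricurve_inj.
- exact: rot_tricurve_image.
- by move=> w; exact: winds_rot_tricurve.
Qed.

Lemma croot_secmap w : ctri w -> croot m (f w / ze) = croot n w.
Proof.
move=> Tw; have [r [a [[r0 _ aA _] uE]]] := ctri_polar n_gt0 Tw.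
rewrite /secmap mulrC mulKf // uE (croot_polar m_gt0) //.
case/andP: (aA) => a0 _; rewrite ger0_norm ?mulrn_wge0 //; apply/ltW.
exact: (angle_bound n_gt0 m_lt).
Qed.

(** In the variable u = (z / ze)^(1/m), both z and its image are powers of u, so
    the difference quotient is a quotient of two polynomials in u. *)
Lemma secdom_derivable z : D z -> derivable phi z 1.
Proof.
move=> Dz; have [z0 Tz] := (secdomE n_gt0 n_le_m m_lt ze_neq0 z).1 Dz.
pose u := croot m (z / ze).
have uE : u = croot n (phi z).
  have [w Tw wz] := Dz.
  rewrite /u -wz (secmapK n_gt0 n_le_m m_lt ze_neq0 (tri_sub Tw)) croot_secmap //.
  exact: tri_sub.
have qm : qsum m u u != 0.
  have [+ _] := qsum_sector m_gt0 (leqnn m) (tri_sub Tz) Tz.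
  by rewrite -uE; apply: contraTneq => ->; rewrite ltxx.
(* uh h is the variable u at the point z + h. *)
pose uh (h : plane R) : plane R := croot m ((h *: (1 : plane R) + z) / ze).
pose q (h : plane R) : plane R := ze^-1 * (qsum n (uh h) u / qsum m (uh h) u).
have hz : (fun h : plane R => (h *: (1 : plane R) + z) / ze) @ (0 : plane R)^' --> z / ze.
  apply: cvg_mul; last exact: cvg_cst.
  rewrite -[X in _ --> X]add0r; apply: cvgD; last exact: cvg_cst.
  rewrite -[X in _ --> X](scale0r (1 : plane R)); apply: cvgZl.
  exact: nbhs_dnbhs.
have uhu : uh @ (0 : plane R)^' --> u by exact: (cvg_croot m_gt0 _ hz).
have hRe : \forall h \near (0 : plane R)^', 0 < Re ((h *: (1 : plane R) + z) / ze).
  exact: (cvgr_gt _ (cvg_Re _ hz) _ z0).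
have qE : {near (0 : plane R)^', q =1 (fun h : plane R => h^-1 *: ((phi \o shift z) (h *: (1 : plane R)) - phi z))}.
  near=> h; rewrite /q /= /secinv -/(uh h) -/u.
  have h0 : h != 0 by near: h; exact: nbhs_dnbhs_neq.
  have hR : 0 < Re ((h *: (1 : plane R) + z) / ze) by near: h.
  have hE : h / ze = (uh h - u) * qsum m (uh h) u.
    rewrite -qsumE (crootK m_gt0 (ltW hR)) (crootK m_gt0 (ltW z0)).
    by rewrite -mulrBl addrK -[h *: _]/(h * 1) mulr1.
  have : h / ze != 0 by rewrite mulf_neq0 // invr_eq0.
  rewrite hE mulf_eq0 negb_or => /andP[d0 q0].
  rewrite qsumE -[h^-1 *: _]/(h^-1 * _).
  have -> : h^-1 = ze^-1 * ((uh h - u) * qsum m (uh h) u)^-1.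
    by rewrite -hE invf_div mulKf.
  rewrite invfM -!mulrA; congr (_ * _); rewrite [RHS]mulrCA.
  by rewrite mulrC mulKf.
have hn : (fun h => qsum n (uh h) u) @ (0 : plane R)^' --> qsum n u u.
  exact: (cvg_qsum _ uhu).
have hm : (fun h => qsum m (uh h) u) @ (0 : plane R)^' --> qsum m u u.
  exact: (cvg_qsum _ uhu).
apply/cvg_ex; exists (ze^-1 * (qsum n u u / qsum m u u)).
apply: cvg_trans (near_eq_cvg qE) _.
have hV : (fun h => (qsum m (uh h) u)^-1) @ (0 : plane R)^' --> (qsum m u u)^-1.
  exact: (cvgV qm hm).
have FF : Filter ((0 : plane R)^') by exact: dnbhs_filter.
exact: (cvg_mul FF (cvg_cst ze^-1) (cvg_mul FF hn hV)).
Unshelve. all: by end_near. Qed.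
End SectorDomain.

(** * Sectors as Jordan domains *)

Section SectorDomainTopology.
Context {R : realType}.
Implicit Types (z w u v : plane R) (x y r s t a : R).
Context (n m : nat) (ze : plane R).
Context (n_gt0 : (0 < n)%N) (n_le_m : (n <= m)%N) (m_lt : (2 * m < 3 * n)%N).
Context (ze_neq0 : ze != 0).

Local Notation f := (secmap n m ze).
Local Notation phi := (secinv n m ze).
Local Notation D := (secdom n m ze).

Lemma secmap_cmod w : ctri w -> cmod (f w) <= cmod ze.
Proof.
move=> Tw; rewrite /secmap cmodM ler_piMr ?cmod_ge0 //.
have cX u k : cmod (u ^+ k) = cmod u ^+ k.
  by elim: k => [|k IH]; rewrite ?expr0 ?exprS ?cmodM ?IH // /cmod /= expr0n expr1n addr0 sqrtr1.
rewrite cX exprn_ile1 ?cmod_ge0 // cmod_croot.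
have := ctri_cmod Tw; rewrite -{1}(rrootK n_gt0 (cmod_ge0 w)).
by rewrite expr_le1 ?rroot_ge0.
Qed.

Lemma bounded_secdom : bounded_set D.
Proof.
exists (cmod ze)%:C; split; first by apply: ger0_real; rewrite (leCR 0) cmod_ge0.
move=> M hM _ [w Tw <-]; apply: le_trans (ltW hM).
by rewrite normE leCR secmap_cmod //; exact: tri_sub.
Qed.

(** The straight segment from w to the centre of the triangle. *)
Definition to_center s w : plane R :=
  bary ((1 - s) * bc1 w + s / 3) ((1 - s) * bc2 w + s / 3).

Lemma to_center_tri s w : 0 <= s <= 1 -> tri w -> tri (to_center s w).
Proof.
move=> /andP[s0 s1] /triE[+ w1 w2]; rewrite /bc0 => w0; apply/triE.
by rewrite /to_center /bc0 !bc1_bary !bc2_bary; split; nra.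
Qed.

Lemma cvg_to_center (T : Type) (F : set_system T) (FF : Filter F)
    (g : T -> R) (h : T -> plane R) s w :
  g @ F --> s -> h @ F --> w -> to_center (g i) (h i) @[i --> F] --> to_center s w.
Proof.
move=> gs hw; have g1 : 1 - g i @[i --> F] --> 1 - s by apply: cvgB => //; exact: cvg_cst.
have g3 : g i / 3 @[i --> F] --> s / 3 by apply: cvgM => //; exact: cvg_cst.
apply: cvg_bary.
  exact: (cvgD (cvgM g1 (cvg_bc1 FF hw)) g3).
exact: (cvgD (cvgM g1 (cvg_bc2 FF hw)) g3).
Qed.

Lemma to_center0 w : to_center 0 w = w.
Proof. by rewrite /to_center subr0 !mul1r !mul0r !addr0 -baryE. Qed.

Lemma to_center1 w : to_center 1 w = bary 3^-1 3^-1.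
Proof. by rewrite /to_center subrr !mul0r !add0r div1r. Qed.

Lemma connected_tri : connected (tri : set (plane R)).
Proof.
have -> : tri = \bigcup_(w in (tri : set (plane R))) ((fun s => to_center s w) @` `[0, 1]).
  apply/seteqP; split => [w Tw|_ [w Tw [s + <-]]].
    by exists w => //; exists 0; rewrite ?to_center0 //= in_itv /= lexx ler01.
  by rewrite /= in_itv /= => s01; exact: to_center_tri.
apply: bigcup_connected.
  exists (bary 3^-1 3^-1) => w Tw; exists 1; last exact: to_center1.
  by rewrite /= in_itv /= lexx ler01.
move=> w Tw; apply: connected_continuous_connected; first exact: segment_connected.
apply: continuous_subspaceT => s.
by apply: cvg_to_center; [exact: cvg_id|exact: cvg_cst].
Qed.

(** Loops are contracted along the images of the segments to the centre of the
    triangle. *)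
Lemma secdom_simply_connected : simply_connected D.
Proof.
split.
  apply: connected_continuous_connected; first exact: connected_tri.
  by apply: continuous_subspaceT; exact: continuous_secmap.
move=> g gC g01 gD.
have gT t : 0 <= t <= 1 -> tri (phi (g t)).
  move=> t01; have : D (g t) by apply: gD; exists t => //=; rewrite in_itv.
  by move=> /(secdomE n_gt0 n_le_m m_lt ze_neq0)[].
have gE t : 0 <= t <= 1 -> f (phi (g t)) = g t.
  move=> t01; have : D (g t) by apply: gD; exists t => //=; rewrite in_itv.
  by move=> /(secdomE n_gt0 n_le_m m_lt ze_neq0)[h _]; exact: (secinvK n_gt0 n_le_m ze_neq0 h).
exists (fun p => f (to_center p.1 (phi (g p.2)))), (f (bary 3^-1 3^-1)); split.
- move/subspace_continuousP: gC => gC; apply/subspace_continuousP => -[s t] [/= s01 t01].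
  apply: (cvg_secmap n_gt0); apply: cvg_to_center.
    apply: cvg_within_filter; exact: cvg_fst.
  apply: (cvg_secinv n_gt0 n_le_m).
  (* Continuity of g within [0, 1] gives continuity of (s, t) |-> g t within
     the square. *)
  have sndN (B : set (plane R)) : nbhs (g t) B ->
      within (`[0, 1] `*` `[0, 1]) (nbhs (s, t)) [set p | B (g p.2)].
    move=> /(gC t t01); rewrite /within /= => hB.
    have h : nbhs (s, t) (snd @^-1` [set x | x \in `[0, 1] -> B (g x)]).
      exists (setT, [set x | x \in `[0, 1] -> B (g x)]).
        by split => //=; exact: filterT.
      by move=> [a b] /= [_].
    by apply: (@filterS _ _ (nbhs_filter (s, t)) _ _ _ h) => -[a b] /= k [_ b01]; exact: k.
  exact: sndN.
- move=> _ [[s t] [/= + +] <-]; rewrite !in_itv /= => s01 t01.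
  by exists (to_center s (phi (g t))) => //; apply: to_center_tri => //; exact: gT.
- by move=> t t01; rewrite /= to_center0 to_center1 gE.
- by move=> s s01; rewrite /= g01.
Qed.

Lemma secdom_jordan : jordan_domain D.
Proof.
split.
- exists (f (bary 3^-1 3^-1)), (bary 3^-1 3^-1) => //.
  by apply/triE; rewrite /bc0 bc1_bary bc2_bary; split; lra.
- exact: open_secdom.
- exact: bounded_secdom.
- exact: secdom_simply_connected.
- by exists (curveA n m ze); have [] := ccwA n_gt0 n_le_m m_lt ze_neq0.
Qed.

Lemma ctri0 : ctri (0 : plane R).
Proof. by rewrite /ctri /bc0 /bc1 /bc2 /=; split; lra. Qed.

Lemma ctri_bary s t : 0 <= s -> 0 <= t -> s + t <= 1 -> ctri (bary s t).
Proof. by move=> s0 t0 st; rewrite /ctri /bc0 /= bc1_bary bc2_bary; split; lra. Qed.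

Lemma bary_real x : bary x 0 = x%:C.
Proof. by rewrite /bary mul0r addr0. Qed.

Lemma bary10 : bary 1 0 = 1 :> plane R.
Proof. by rewrite bary_real. Qed.

Lemma bary01 : bary 0 1 = omega :> plane R.
Proof. by rewrite /bary mul1r add0r. Qed.

Lemma secdom_cardy : cardy_map D (f 0) (f 1) (f omega) phi.
Proof.
have K := secmapK n_gt0 n_le_m m_lt ze_neq0.
have T1 : ctri (1 : plane R) by rewrite -bary10; apply: ctri_bary; lra.
have To : ctri (omega : plane R) by rewrite -bary01; apply: ctri_bary; lra.
split.
- by move=> z; exact: secdom_derivable.
- split.
  + by move=> _ [w Tw <-]; rewrite (K _ (tri_sub Tw)).
  + move=> z w /set_mem[z' Tz <-] /set_mem[w' Tw <-].
    move=> e; congr (f _).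
    exact: etrans (esym (K _ (tri_sub Tz))) (etrans e (K _ (tri_sub Tw))).
  + by move=> w Tw; exists (f w); [exists w|exact: K (tri_sub Tw)].
- by apply: continuous_subspaceT; exact: continuous_secinv.
- by split; [exact: K ctri0|exact: K T1|exact: K To].
Qed.

Lemma secdom_ccw4 X : 0 < X < 1 -> ccw4 D (f 0) (f X%:C) (f 1) (f omega).
Proof.
move=> /andP[X0 X1].
exists (curveA n m ze), (X / 3), (1/3), (2/3); split.
- exact: ccwA.
- by split; lra.
- have e1 : tricurve (X / 3) = X%:C.
    have -> : tricurve (X / 3) = bary (3 * (X / 3)) 0 by apply: tricurve_side0; lra.
    have -> : 3 * (X / 3) = X by field.
    exact: bary_real.
  have e2 : tricurve (1 / 3) = 1 :> plane R.
    have -> : tricurve (1 / 3) = bary (3 * (1 / 3)) 0 :> plane R.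
      by apply: tricurve_side0; lra.
    have -> : 3 * (1 / 3) = 1 :> R by field.
    exact: bary10.
  have e3 : tricurve (2 / 3) = omega :> plane R.
    have -> : tricurve (2 / 3) = bary (2 - 3 * (2 / 3)) (3 * (2 / 3) - 1) :> plane R.
      by apply: tricurve_side1; lra.
    have -> : 2 - 3 * (2 / 3) = 0 :> R by field.
    have -> : 3 * (2 / 3) - 1 = 1 :> R by field.
    exact: bary01.
  by rewrite /curveA /= tricurve0 e1 e2 e3; split.
Qed.

End SectorDomainTopology.

(** * Arcs of an oriented Jordan curve *)

Section ArcUniqueness.
Context {R : realType}.
Implicit Types (z w u v : plane R) (x y r s t a : R).

(** A continuous angle along which the unit vector is constant is constant. *)
Lemma angle_const (d : R -> R) x y : x <= y -> {within `[x, y], continuous d} ->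
  (forall t, x <= t <= y -> expi (d t) = 1 :> plane R) -> d x = d y.
Proof.
move=> xy dC d1; have pi0 := pi_gt0 R; apply: contrapT => /eqP dxy.
have d1x : expi (d x) = 1 :> plane R by apply: d1; rewrite lexx.
(* Otherwise d takes a value v at positive distance less than 2 pi from d x. *)
suff [v [vI vn vpi]] : exists v : R, [/\ Num.min (d x) (d y) <= v <= Num.max (d x) (d y),
    v != d x & `|v - d x| < 2 * pi].
  have [c] := IVT xy dC vI; rewrite in_itv /= => /d1 dc cv.
  have /eqP[] := vn; apply: (@expi_inj R) => //.
  by rewrite -cv dc d1x.
case: (ltgtP (d x) (d y)) dxy => // xyd _.
- have [h|h] := leP (d y - d x) pi.
    exists (d y); rewrite lexx (ltW xyd) gt_eqF //; split => //.
    by rewrite gtr0_norm ?subr_gt0 //; lra.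
  exists (d x + pi); split; [apply/andP; split; lra|by rewrite gt_eqF // ltrDl|].
  by rewrite addrAC subrr add0r gtr0_norm //; lra.
- have [h|h] := leP (d x - d y) pi.
    exists (d y); rewrite lexx (ltW xyd) lt_eqF //; split => //.
    by rewrite ltr0_norm ?subr_lt0 //; lra.
  exists (d x - pi); split; [apply/andP; split; lra|by rewrite lt_eqF // ltrBlDr ltrDl|].
  by rewrite addrAC subrr add0r normrN gtr0_norm //; lra.
Qed.

(** Two parametrizations of a closed curve with the same base point pass
    through the same other points. *)
Lemma jordan_reparam (g0 g : R -> plane R) (J : set (plane R)) t :
  jordan_param g0 J -> jordan_param g J -> g 0 = g0 0 -> 0 < t < 1 ->
  exists x, 0 < x < 1 /\ g0 x = g t.
Proof.
move=> [_ g001 _ im0] [_ g01 ginj im] gg0 /andP[t0 t1].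
have : J (g t) by rewrite -im; exists t => //=; rewrite in_itv /= !ltW.
rewrite -im0 => -[x + xE]; rewrite /= in_itv /= => /andP[x0 x1].
have tn0 : g t <> g 0.
  move=> /ginj h; have tt : t = 0 by apply: h; rewrite in_itv /= ?lexx ?ltr01 ?t1 ?ltW.
  by rewrite tt ltxx in t0.
exists x; split => //; rewrite !lt_neqAle x0 x1 !andbT; apply/andP; split.
- by apply/eqP => xx; apply: tn0; rewrite gg0 -xE -xx.
- by apply/eqP => xx; apply: tn0; rewrite gg0 g001 -xE -xx.
Qed.

Lemma right_bound (d : R -> R) : {within `[0, 1], continuous d} ->
  exists2 x : R, 0 < x < 1 & forall y, 0 < y <= x -> `|d 0 - d y| < 1.
Proof.
move=> /(continuous_within_itvP d ltr01)[_ /cvgrPdist_lt/(_ 1 ltr01) d0 _].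
move: d0 => [e /= e0 de]; exists (Num.min (e / 2) 2^-1).
  by rewrite lt_min gt_min divr_gt0 //=; apply/andP; split; [lra|apply/orP; right; lra].
move=> y /andP[y0]; rewrite le_min => /andP[y1 y2]; apply: de => //=.
by rewrite sub0r normrN gtr0_norm //; lra.
Qed.

Lemma left_bound (d : R -> R) : {within `[0, 1], continuous d} ->
  exists2 x : R, 0 < x < 1 & forall y, x <= y < 1 -> `|d 1 - d y| < 1.
Proof.
move=> /(continuous_within_itvP d ltr01)[_ _ /cvgrPdist_lt/(_ 1 ltr01) d0].
move: d0 => [e /= e0 de]; exists (Num.max (1 - e / 2) 2^-1).
  by rewrite lt_max gt_max; apply/andP; split; [apply/orP; right; lra|apply/andP; split; lra].
move=> y /andP[+ y0]; rewrite ge_max => /andP[y1 y2]; apply: de => //=.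
by rewrite ger0_norm ?subr_ge0 ?ltW //; lra.
Qed.

Section Reparam.
Context (g0 g : R -> plane R) (J : set (plane R)).
Context (g0J : jordan_param g0 J) (gJ : jordan_param g J) (gg0 : g 0 = g0 0).

(** The parameter along [g0] of the point that [g] reaches at time t. *)
Let h t : R := xget 0 [set x | 0 < x < 1 /\ g0 x = g t].

Let hP t : 0 < t < 1 -> 0 < h t < 1 /\ g0 (h t) = g t.
Proof. by move=> t01; exact: (xgetPex 0 (jordan_reparam g0J gJ gg0 t01)). Qed.

Let h_uniq t x : 0 < t < 1 -> 0 <= x <= 1 -> g0 x = g t -> x = h t.
Proof.
move=> t01 /andP[x0 x1] xE; have [_ g001 inj0 _] := g0J.
have [/andP[h0 h1] hE] := hP t01.
have inI y : 0 < y -> y < 1 -> y \in `[0, 1[ by move=> y0 y1; rewrite in_itv /= ltW.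
case: (ltgtP x 1) x1 => // [x1|x1] _.
  by apply: inj0; [rewrite in_itv /= x0|exact: inI|rewrite hE].
have /inj0 e : g0 (h t) = g0 0 by rewrite hE -xE x1 g001.
by move: (h0); rewrite e ?ltxx ?(inI _ h0 h1) // in_itv /= lexx ltr01.
Qed.

Let g_at t : 0 < t < 1 -> {for t, continuous g}.
Proof.
move=> t01; have [gC _ _ _] := gJ.
have [+ _ _] := (continuous_within_itvP g ltr01).1 gC.
by apply; rewrite in_itv.
Qed.

Let closed_arc x y : 0 <= x -> y <= 1 -> closed (g0 @` `[x, y]).
Proof.
move=> x0 y1; have [g0C _ _ _] := g0J.
apply: compact_closed; first exact: norm_hausdorff.
apply: continuous_compact; last exact: segment_compact.
apply: continuous_subspaceW g0C => t /=; rewrite !in_itv /= => /andP[t1 t2].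
by rewrite (le_trans x0 t1) (le_trans t2 y1).
Qed.

(** The image of a compact arc is closed, so h t cannot jump. *)
Let h_cont t : 0 < t < 1 -> {for t, continuous h}.
Proof.
move=> t01; have [/andP[h0 h1] hE] := hP t01; case/andP: (t01) => t0 t1.
apply/cvgrPdist_lt => e' e0'; have [e ee e0] : exists2 e : R, e = e' & 0 < e by exists e'.
rewrite -{e' e0'}ee.
pose A := g0 @` `[0, h t - e] `|` g0 @` `[h t + e, 1].
have nA : (~` A) (g t).
  case=> -[x]; rewrite /= in_itv /= => /andP[x0 x1] xE.
    have hx : x = h t.
      by apply: h_uniq => //; rewrite x0 (le_trans x1) // lerBlDr; lra.
    by move: x1; rewrite hx; lra.
  have hx : x = h t.
    by apply: h_uniq => //; rewrite x1 andbT (le_trans _ x0) //; lra.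
  by move: x0; rewrite hx; lra.
have oA : open (~` A).
  by apply/closed_openC/closedU; apply: closed_arc; lra.
have nearA : \forall s \near t, (~` A) (g s) by exact: (g_at t01 (open_nbhs_nbhs (conj oA nA))).
near=> s.
have s01 : 0 < s < 1.
  by apply/andP; split; near: s; [exact: lt_nbhsr|exact: lt_nbhsl].
have [/andP[hs0 hs1] hsE] := hP s01.
have nAs : (~` A) (g s) by near: s.
rewrite ltr_norml; apply/andP; split; rewrite ltNge; apply/negP => far; apply: nAs.
- by right; exists (h s) => //=; rewrite in_itv /=; apply/andP; split; lra.
- by left; exists (h s) => //=; rewrite in_itv /=; apply/andP; split; lra.
Unshelve. all: by end_near. Qed.

Let h_mono : unstable.strict_monotonic `]0, 1[ h.
Proof.
apply: itv_continuous_inj_mono.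
  rewrite continuous_open_subspace; last exact: itv_open.
  by move=> t; rewrite inE /= in_itv /=; exact: h_cont.
move=> s t; rewrite !in_itv /= => s01 t01 hst; have [_ _ ginj _] := gJ.
have inI y : 0 < y < 1 -> y \in `[0, 1[ by move=> /andP[y0 y1]; rewrite in_itv /= ltW.
apply: ginj; rewrite ?inI //.
by rewrite -(hP s01).2 -(hP t01).2 hst.
Qed.

Context (z0 : plane R).
Context (z0J : ~ J z0) (w0 : winds g0 z0 1) (w : winds g z0 1).

Let h_surj x : 0 < x < 1 -> exists2 t, 0 < t < 1 & h t = x.
Proof.
move=> x01; have [t [t01 tE]] := jordan_reparam gJ g0J (esym gg0) x01.
exists t => //; apply/esym; apply: h_uniq => //.
by case/andP: x01 => x0 x1; rewrite !ltW.
Qed.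

(** A decreasing h would make [g] run along the curve backwards, and the total
    variation of the angle along [g] would be - 2 pi. *)
Let h_incr : {in `]0, 1[ &, {homo h : x y / x < y}}.
Proof.
have [//|hdec] := h_mono; exfalso.
have {}hdec s t : 0 < s -> s < t -> t < 1 -> h t < h s.
  move=> s0 st t1; apply: hdec => //; rewrite in_itv /=.
    by rewrite t1 (lt_trans s0 st).
  by rewrite s0 (lt_trans st t1).
have [th [thC thE th01]] := w; have [th0 [th0C th0E th001]] := w0.
pose d t := th t - th0 (h t).
have le01 t : 0 < t < 1 -> 0 <= t <= 1 by move=> /andP[? ?]; rewrite !ltW.
have d1 t : 0 < t < 1 -> expi (d t) = 1 :> plane R.
  move=> t01; have [h01 hE] := hP t01.
  have nz : `|g t - z0| != 0.
    rewrite normr_eq0 subr_eq0; apply/eqP => gz; apply: z0J; rewrite -gz.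
    by have [_ _ _ <-] := gJ; exists t => //=; rewrite in_itv /= le01.
  have a1 := thE _ (le01 _ t01).
  have a2 : g t - z0 = `|g t - z0| * expi (th0 (h t)).
    by rewrite -hE; exact: th0E (le01 _ h01).
  have e := mulfI nz (etrans (esym a1) a2).
  by rewrite /d expiD e -expiD subrr expi0.
have th_at (f : R -> R) (t : R) : {within `[0, 1], continuous f} -> 0 < t < 1 -> {for t, continuous f}.
  move=> fC t01; have [+ _ _] := (continuous_within_itvP f ltr01).1 fC.
  by apply; rewrite in_itv.
have dconst s t : 0 < s < 1 -> 0 < t < 1 -> s <= t -> d s = d t.
  move=> /andP[s0 s1] /andP[t0 t1] st.
  have in01 r : s <= r <= t -> 0 < r < 1.
    by move=> /andP[sr rt]; rewrite (lt_le_trans s0 sr) (le_lt_trans rt t1).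
  apply: angle_const => //; last by move=> r /in01/d1.
  apply: continuous_in_subspaceT => r; rewrite inE /= in_itv /= => /in01 r01.
  apply: cvgB; first exact: th_at.
  have [h01 _] := hP r01.
  by apply: (@continuous_comp _ _ _ h th0); [exact: h_cont|exact: th_at].
(* At times t near 0 and s near 1, the angles are within 1 of their end values;
   since d t = d s, this leaves a gap of at most 4, less than 4 pi. *)
have [x x01 xP] := left_bound th0C; have [x' x'01 x'P] := right_bound thC.
have [y y01 yP] := right_bound th0C; have [y' y'01 y'P] := left_bound thC.
have [t1 t101 t1E] := h_surj x01; have [s1 s101 s1E] := h_surj y01.
pose t := Num.min t1 x' / 2; pose s := (Num.max s1 y' + 1) / 2.
have t_lt : 0 < t /\ t < t1 /\ t < x'.
  rewrite /t; case: (leP t1 x') => ?; lra.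
have s_gt : s < 1 /\ s1 < s /\ y' < s.
  rewrite /s; case: (leP s1 y') => ?; lra.
case: t_lt => tp [tt1 tx']; case: s_gt => sm [ss1 sy'].
have t01 : 0 < t < 1 by lra.
have s01 : 0 < s < 1 by lra.
have [ht01 _] := hP t01; have [hs01 _] := hP s01.
have e1 : `|th 0 - th t| < 1 by apply: x'P; lra.
have e2 : `|th0 1 - th0 (h t)| < 1.
  apply: xP; rewrite -t1E; have := hdec t t1 tp tt1 ltac:(lra); lra.
have e3 : `|th 1 - th s| < 1 by apply: y'P; lra.
have e4 : `|th0 0 - th0 (h s)| < 1.
  apply: yP; rewrite -s1E; have := hdec s1 s ltac:(lra) ss1 sm; lra.
have dts : d t = d s.
  by case: (leP t s) => [|/ltW] ts; [|apply/esym]; exact: dconst.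
have pi2 := pi_ge2 R.
move: dts th01 th001; rewrite /d !mulr1; move: e1 e2 e3 e4; rewrite !ltr_norml.
lra.
Qed.

(** Two parametrizations with the same base point and winding number 1 describe
    the same arc from the base point to a given point. *)
Lemma arc_sub s t : 0 <= s < 1 -> 0 <= t < 1 -> g t = g0 s ->
  g @` `[0, t] `<=` g0 @` `[0, s].
Proof.
move=> /andP[s0 s1] /andP[t0 t1] gts _ [x + <-]; rewrite /= in_itv /= => /andP[x0 xt].
have [tz|tn0] := eqVneq t 0.
  by exists 0; rewrite /= ?in_itv /= ?lexx //; rewrite -gg0; congr g; lra.
have t01 : 0 < t < 1 by rewrite lt0r tn0 t0.
have hs : s = h t by apply: h_uniq; rewrite // s0 ltW.
have [xz|xn0] := eqVneq x 0.
  by exists 0; rewrite /= ?in_itv /= ?lexx // -gg0 xz.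
have x01 : 0 < x < 1 by rewrite lt0r xn0 x0 (le_lt_trans xt).
have [/andP[hx0 hx1] hxE] := hP x01.
exists (h x) => //=; rewrite in_itv /= ltW //= hs.
have [->//|xnt] := eqVneq x t.
by apply/ltW/h_incr; rewrite ?in_itv // lt_neqAle xnt.
Qed.

End Reparam.

(** The arc [bdarc] is described by any one positively oriented parametrization. *)
Lemma bdarcE (D : set (plane R)) (g0 : R -> plane R) s : open D -> D !=set0 ->
  ccw_param D g0 -> 0 <= s < 1 -> bdarc D (g0 0) (g0 s) = g0 @` `[0, s].
Proof.
move=> oD [z0 Dz0] gD s01; have [g0J g0w] := gD.
have nJ : ~ boundary D z0 by rewrite /boundary ((interior_id D).1 oD) => -[_]; apply.
apply/seteqP; split => [z [g [t [[gJ gw] gg0 t01 gt gz]]]|z gz]; last by exists g0, s.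
exact: (arc_sub g0J gJ gg0 nJ (g0w _ Dz0) (gw _ Dz0) s01 t01 gt).
Qed.

End ArcUniqueness.

(** * Boundary arcs of a sector *)

Section SectorArcs.
Context {R : realType}.
Implicit Types (z w u v : plane R) (x y r s t a X : R).

Lemma tricurve_third x : 0 <= x -> x <= 1 -> tricurve (x / 3) = x%:C.
Proof.
move=> x0 x1; have -> : tricurve (x / 3) = bary (3 * (x / 3)) 0 by apply: tricurve_side0; lra.
have -> : 3 * (x / 3) = x by field.
exact: bary_real.
Qed.

Lemma rot_tricurve_third x : 0 <= x -> x <= 1 -> rot (tricurve (x / 3)) = bary (1 - x) x.
Proof.
move=> x0 x1; rewrite tricurve_third // rotE -bary_real.
by rewrite /bc0 bc1_bary bc2_bary subr0.
Qed.

Lemma third_image (g h : R -> plane R) X :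
  (forall x, 0 <= x -> x <= X -> g (x / 3) = h x) ->
  g @` `[0, X / 3] = h @` `[0, X].
Proof.
move=> gh; apply/seteqP; split => [_ [t + <-]|_ [x + <-]];
  rewrite /= in_itv /= => /andP[t0 t1].
  exists (3 * t); first by rewrite /= in_itv /=; apply/andP; split; lra.
  have -> : t = 3 * t / 3 by field.
  by rewrite gh; [congr h; field|lra|lra].
exists (x / 3); first by rewrite /= in_itv /=; apply/andP; split; lra.
exact: gh.
Qed.

Context (n m : nat) (ze : plane R).
Context (n_gt0 : (0 < n)%N) (n_le_m : (n <= m)%N) (m_lt : (2 * m < 3 * n)%N).
Context (ze_neq0 : ze != 0).

Local Notation f := (secmap n m ze).
Local Notation D := (secdom n m ze).

Lemma secdom_arc0 X : 0 <= X -> X <= 1 ->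
  bdarc D (f 0) (f X%:C) = (fun x => f x%:C) @` `[0, X].
Proof.
move=> X0 X1; have [Dn0 oD _ _ _] := secdom_jordan n_gt0 n_le_m m_lt ze_neq0.
have cE x : 0 <= x -> x <= X -> curveA n m ze (x / 3) = f x%:C.
  by move=> x0 x1; rewrite /curveA /= tricurve_third // (le_trans x1).
have s01 : 0 <= X / 3 < 1 by apply/andP; split; lra.
have := bdarcE oD Dn0 (ccwA n_gt0 n_le_m m_lt ze_neq0) s01.
rewrite (third_image cE) (cE X X0 (lexx X)).
have -> : curveA n m ze 0 = f 0 by rewrite /curveA /= tricurve0.
exact.
Qed.

Lemma secdom_arc1 :
  bdarc D (f 1) (f omega) = (fun x => f (bary (1 - x) x)) @` `[0, 1].
Proof.
have [Dn0 oD _ _ _] := secdom_jordan n_gt0 n_le_m m_lt ze_neq0.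
have cE x : 0 <= x -> x <= 1 -> curveB n m ze (x / 3) = f (bary (1 - x) x).
  by move=> x0 x1; rewrite /curveB /= rot_tricurve_third.
have s01 : (0 : R) <= (1 : R) / 3 < 1.
  by rewrite divr_ge0 ?ler01 //= ltr_pdivrMr ?mul1r ?ltr1n.
have := bdarcE oD Dn0 (ccwB n_gt0 n_le_m m_lt ze_neq0) s01.
rewrite (third_image cE) (cE 1 ler01 (lexx 1)) subrr bary01.
have -> : curveB n m ze 0 = f 1.
  by rewrite -(mul0r 3^-1) (cE 0 (lexx 0) ler01) subr0 bary10.
exact.
Qed.

End SectorArcs.

(** * Percolation events *)

Section Percolation.
Context {R : realType}.
Local Open Scope ereal_scope.

(** The event that all the sites of s are open. *)
Definition all_open (s : seq (int * int)) : set configT := [set w : config | all w s].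

Lemma all_open_cat s t : all_open (s ++ t) = all_open s `&` all_open t.
Proof.
apply/seteqP; split => w; first by rewrite /all_open /= all_cat => /andP.
by move=> [ws wt]; rewrite /all_open /= all_cat; apply/andP.
Qed.

Lemma measurable_site v : measurable ([set w : config | w v] : set configT).
Proof. by apply: sub_sigma_algebra; exists v. Qed.

Lemma measurable_all_open s : measurable (all_open s).
Proof.
elim: s => [|v s IH].
  by rewrite (_ : all_open [::] = setT) //; apply/seteqP; split.
rewrite -cat1s all_open_cat; apply: measurableI => //.
rewrite (_ : all_open [:: v] = [set w : config | w v]); first exact: measurable_site.
by apply/seteqP; split => w; rewrite /all_open /= andbT.
Qed.

(** A class of events, stable under intersection, that generates the
    sigma-algebra. *)
Definition open_sets : set (set configT) := [set A | exists s, A = all_open s].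

Lemma open_sets_generate : @measurable _ configT = <<s open_sets >>.
Proof.
apply/seteqP; split; apply: smallest_sub; try exact: smallest_sigma_algebra.
- move=> _ [v ->]; apply: sub_sigma_algebra; exists [:: v].
  by apply/seteqP; split => w; rewrite /all_open /= andbT.
- move=> _ [s ->]; exact: measurable_all_open.
Qed.

Lemma product_bernoulli_all_open (p : R) (P : probability configT R) s :
  product_bernoulli p P -> P (all_open s) = (p ^+ size (undup s))%:E.
Proof.
move=> hP; have := hP (undup s) (fun=> true) (undup_uniq s).
rewrite big_const_seq count_predT iter_mulr_1 => <-; congr (P _).
apply/seteqP; split => w; rewrite /all_open /=.
  by move=> /allP ws v; rewrite mem_undup => /ws.
by move=> ws; apply/allP => v vs; rewrite ws // mem_undup.
Qed.

Lemma relabel_measurable (si : int * int -> int * int) :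
  measurable_fun setT ((fun w : config => w \o si) : configT -> configT).
Proof.
apply: (measurability _ open_sets_generate) => _ [_ [s ->] <-]; rewrite setTI.
rewrite (_ : _ @^-1` _ = all_open (map si s)); first exact: measurable_all_open.
by apply/seteqP; split => w; rewrite /all_open /= all_map.
Qed.

(** Relabelling the sites by an injection preserves the product law. *)
Lemma relabel_prob (p : R) (P : probability configT R) si (E : set configT) :
  product_bernoulli p P -> injective si -> measurable E ->
  P ((fun w : config => w \o si) @^-1` E) = P E.
Proof.
move=> hP si_inj mE.
pose m2 := measure_function_pushforward__canonical__measure_function_Measure P (relabel_measurable si).
rewrite -[LHS]/(m2 E).
apply: (measure_unique open_sets (fun=> setT) open_sets_generate) => //.
- move=> _ _ [s ->] [t ->]; exists (s ++ t); exact/esym/all_open_cat.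
- by move=> _; exists [::]; apply/seteqP; split.
- by apply/seteqP; split => // w _; exists 0%N.
- move=> _ [s ->]; rewrite [RHS](product_bernoulli_all_open _ hP).
  rewrite -[LHS]/(P ((fun w : config => w \o si) @^-1` all_open s)).
  rewrite (_ : _ @^-1` _ = all_open (map si s)).
    by rewrite (product_bernoulli_all_open _ hP) undup_map_inj // size_map.
  by apply/seteqP; split => w; rewrite /all_open /= all_map.
- move=> _; rewrite -[X in X < _]/(P setT).
  by rewrite probability_setT ltry.
Qed.

(** For a given path, the geometric condition does not depend on the
    configuration; and there are countably many paths. *)
Lemma measurable_crossing (G : lattice R) (D A B : set (plane R)) :
  measurable (crossing G D A B : set configT).
Proof.
pose Q (q : (int * int) * seq (int * int)) : Prop :=
  path (adj G) q.1 q.2 && uniq (q.1 :: q.2) /\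
    let L := polyline [seq pos G u | u <- q.1 :: q.2] in
    exists t1 t2 : R,
      [/\ (0 <= t1)%R, (t1 <= t2)%R, (t2 <= (size q.2)%:R)%R,
          forall t, (t1 <= t <= t2)%R -> closure D (L t)
        & A (L t1) /\ B (L t2) \/ B (L t1) /\ A (L t2)].
pose F q : set configT := if `[< Q q >] then all_open (q.1 :: q.2) else set0.
rewrite (_ : crossing _ _ _ _ = \bigcup_q F q).
  apply: countable_bigcupT_measurable => [|q]; first exact: countableP.
  by rewrite /F; case: ifP => _; [exact: measurable_all_open|exact: measurable0].
apply/seteqP; split => [w [v [s [/and3P[h1 h2 h3] h]]]|w [[v s] _]].
  exists (v, s) => //; rewrite /F; case: asboolP => // nQ; case: nQ.
  by split => //=; rewrite h1.
rewrite /F; case: asboolP => // -[/= h12 h] hw; exists v, s; split => //.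
by rewrite /open_path andbA h12.
Qed.

(** If the supremum is over the empty set, it is 0 by convention. *)
Lemma p_c_itv (P : R -> probability configT R) (G : lattice R) : (0 <= p_c P G <= 1)%R.
Proof.
rewrite /p_c; set S := [set p : R | _].
have [[p Sp]|/nonemptyPn ->] := pselect (S !=set0); last by rewrite sup0 lexx ler01.
have ubS : ubound S 1%R by move=> q [/andP[]].
have [/andP[p0 p1] _] := Sp.
rewrite (le_trans p0) //=; last by apply: ub_le_sup => //; exists 1%R.
by apply: ge_sup => //; exists p.
Qed.

(** The law at the critical point is a product law, hence invariant under
    relabelling. *)
Lemma crossing_prob_le (P : R -> probability configT R) (G : lattice R) si
    (D A B D' A' B' : set (plane R)) :
  (forall p : R, (0 <= p <= 1)%R -> product_bernoulli p (P p)) ->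
  injective si ->
  (forall w, crossing G D A B w -> crossing G D' A' B' (w \o si)) ->
  (crossing_prob P G D A B <= crossing_prob P G D' A' B')%R.
Proof.
move=> hP si_inj sub; rewrite /crossing_prob; set p := p_c P G.
rewrite fine_le ?fin_num_measure //; try exact: measurable_crossing.
rewrite -[leRHS](relabel_prob (hP _ (p_c_itv P G)) si_inj (measurable_crossing G D' A' B')).
apply: le_measure; rewrite ?inE //; first exact: measurable_crossing.
rewrite -[X in measurable X]setTI; apply: relabel_measurable => //.
exact: measurable_crossing.
Qed.

End Percolation.

(** * Crossings transported by a linear map *)

Section CrossingTransfer.
Context {R : realType}.
Implicit Types (z w : plane R) (x y r t : R).

(** A polygonal curve extended by constants to a curve on the whole line. *)
Fixpoint polygon (x0 : plane R) (s : seq (plane R)) t : plane R :=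
  if s is y :: s' then polygon y s' (t - 1) + (1 - clamp t)%:C * (x0 - y) else x0.

Lemma polygon_le0 (x0 : plane R) s t : t <= 0 -> polygon x0 s t = x0.
Proof.
elim: s x0 t => [//|y s IH] x0 t t0 /=.
rewrite IH; last lra.
by rewrite clamp_le0 // subr0 mul1r addrC subrK.
Qed.

Lemma polylineE (x0 : plane R) s t : 0 <= t <= (size s)%:R ->
  polyline (x0 :: s) t = polygon x0 s t.
Proof.
elim: s x0 t => [|y s IH] x0 t /andP[t0 t1].
  have -> : t = 0 by apply: le_anti; rewrite t0 andbT.
  by rewrite /polyline truncn0 subr0 /= mul0r addr0 subr0 mul1r.
have [t_lt|t_ge] := ltP t 1.
  have tr : Num.truncn t = 0%N by apply: truncn_def; rewrite t0.
  rewrite /polyline tr subr0 /= polygon_le0; last lra.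
  rewrite (clamp_mid t0 (ltW t_lt)).
  by apply: complexP; rewrite ?(cReD, cImD, cReM, cImM, cReB, cImB) /=; ring.
have t1' : 0 <= t - 1 by lra.
have tr : Num.truncn t = (Num.truncn (t - 1)).+1.
  apply: truncn_def; have /andP[a1 a2] := truncn_itv t1'.
  by rewrite -[X in X%:R <= _]addn1 -[X in _ < X%:R]addn1 !natrD; apply/andP; split; lra.
rewrite /= clamp_ge1 // subrr mul0r addr0 -IH; last first.
  by rewrite t1' /= lerBlDr; move: t1; rewrite /= -addn1 natrD.
rewrite /polyline tr /=.
have -> : t - (Num.truncn (t - 1)).+1%:R = t - 1 - (Num.truncn (t - 1))%:R.
  by rewrite -addn1 natrD; ring.
by [].
Qed.

Lemma cvg_polygon (T : Type) (F : set_system T) (FF : Filter F)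
    (x0 : plane R) s (g : T -> R) t :
  g @ F --> t -> polygon x0 s (g i) @[i --> F] --> polygon x0 s t.
Proof.
elim: s x0 g t => [|y s IH] x0 g t gt /=; first exact: cvg_cst.
have g1 : g i - 1 @[i --> F] --> t - 1 by apply: cvgB => //; exact: cvg_cst.
have g2 : 1 - clamp (g i) @[i --> F] --> 1 - clamp t.
  by apply: cvgB; [exact: cvg_cst|exact: cvg_clamp].
exact: (cvg_add FF (IH y _ _ g1) (cvg_mul FF (cvg_rC FF g2) (cvg_cst _))).
Qed.

(** The real-linear map of the plane taking 1 to a and the imaginary unit to b. *)
Definition rlin (a b : plane R) z : plane R := (Re z)%:C * a + (Im z)%:C * b.

Lemma rlinD a b z w : rlin a b (z + w) = rlin a b z + rlin a b w.
Proof. by rewrite /rlin cReD cImD !rmorphD /=; ring. Qed.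

Lemma rlinZ a b x z : rlin a b (x%:C * z) = x%:C * rlin a b z.
Proof. by rewrite /rlin cReM cImM /= !mul0r subr0 addr0 !rmorphM /=; ring. Qed.

Lemma rlin0 a b : rlin a b 0 = 0.
Proof. by rewrite /rlin /= !mul0r addr0. Qed.

Lemma cvg_rlin (T : Type) (F : set_system T) (FF : Filter F) a b (g : T -> plane R) z :
  g @ F --> z -> rlin a b (g i) @[i --> F] --> rlin a b z.
Proof.
move=> gz; exact: (cvg_add FF
  (cvg_mul FF (cvg_rC FF (cvg_Re FF gz)) (cvg_cst _))
  (cvg_mul FF (cvg_rC FF (cvg_Im FF gz)) (cvg_cst _))).
Qed.

Lemma polyline_rlin a b (s : seq (plane R)) t :
  polyline [seq rlin a b z | z <- s] t = rlin a b (polyline s t).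
Proof.
have nthN i : nth 0 [seq rlin a b z | z <- s] i = rlin a b (nth 0 s i).
  have [h|h] := ltnP i (size s); first exact: nth_map.
  by rewrite !nth_default ?size_map // rlin0.
by rewrite /polyline !nthN rlinD !rlinZ.
Qed.

(** The first time at which a curve in the angle spanned by 1 and omega meets the
    third side of the triangle. *)
Lemma first_hit (c : R -> plane R) t1 t2 : t1 <= t2 -> continuous c ->
  (forall t, t1 <= t <= t2 -> 0 <= bc1 (c t) /\ 0 <= bc2 (c t)) ->
  bc1 (c t1) + bc2 (c t1) < 1 -> 1 <= bc1 (c t2) + bc2 (c t2) ->
  exists t3, [/\ t1 <= t3 <= t2, forall t, t1 <= t <= t3 -> ctri (c t) &
    exists2 x, 0 <= x <= 1 & c t3 = bary (1 - x) x].
Proof.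
move=> t12 cC cpos k1 k2.
pose k t := bc1 (c t) + bc2 (c t).
have kC : continuous k.
  by move=> t; apply: cvgD; [apply: cvg_bc1|apply: cvg_bc2]; exact: cC.
pose E := `[t1, t2]%classic `&` k @^-1` [set x | 1 <= x].
have cE : compact E.
  apply: compact_closedI; first exact: segment_compact.
  by apply: closed_comp => [t _|]; [exact: kC|exact: closed_ge].
have E2 : E t2 by split => //=; rewrite in_itv /= t12 lexx.
have idC : {within E, continuous (id : R -> R)}.
  by apply: continuous_subspaceT => t; exact: cvg_id.
have [t3 /set_mem[+ k3] t3min] := compact_EVT_min (ex_intro _ t2 E2) cE idC.
rewrite /= in_itv /= => /andP[t13 t32].
have klt t : t1 <= t -> t < t3 -> k t < 1.
  move=> t1t tt3; rewrite ltNge; apply/negP => kt.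
  have : t3 <= t by apply: t3min; rewrite inE; split => //=; rewrite in_itv /= t1t ltW // (lt_le_trans tt3).
  lra.
have k3E : k t3 = 1.
  have [||x] := @IVT R k t1 t3 1 t13 _ _.
  - exact: continuous_subspaceT.
  - rewrite /= in k3; rewrite ge_min le_max k3 orbT andbT.
    by rewrite /k (ltW k1).
  rewrite in_itv /= => /andP[x1 x3] kx.
  have [->//|xn] := eqVneq t3 x.
  have := klt x x1; rewrite lt_neqAle x3 eq_sym xn kx ltxx => h.
  by have := h isT.
exists t3; split; first by rewrite t13.
- move=> t /andP[t1t tt3].
  have [c1 c2] : 0 <= bc1 (c t) /\ 0 <= bc2 (c t) by apply: cpos; rewrite t1t (le_trans tt3).
  have : k t <= 1.
    by have [->|tn] := eqVneq t t3; [rewrite k3E|apply/ltW/klt; rewrite // lt_neqAle tn].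
  by rewrite /k => kt; split => //; rewrite /bc0; lra.
- have [c1 c2] : 0 <= bc1 (c t3) /\ 0 <= bc2 (c t3) by apply: cpos; rewrite t13.
  rewrite /k in k3E; exists (bc2 (c t3)); first by apply/andP; split; lra.
  by rewrite {1}(baryE (c t3)); congr bary; lra.
Qed.

(** Let the linear map [rlin a b] act on the lattice, by tau on its labels. If it
    takes D into the angle spanned by u and u omega, A into the segment
    from 0 to u X, and B beyond the third side of the triangle of base u,
    then a crossing from A to B in D contains, after the map, a crossing of that
    triangle, which stops where the path first meets the third side. *)
Lemma crossing_transfer (G : lattice R) (tau si : int * int -> int * int)
    (a b u : plane R) (X : R) (D A B D' A' B' : set (plane R)) (w : config) :
  (forall v, rlin a b (pos G v) = pos G (tau v)) ->
  (forall v v', adj G v v' -> adj G (tau v) (tau v')) ->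
  cancel tau si -> u != 0 -> X < 1 ->
  (forall z, closure D z -> 0 <= bc1 (rlin a b z / u) /\ 0 <= bc2 (rlin a b z / u)) ->
  (forall z, A z -> exists2 x, 0 <= x <= X & rlin a b z = u * x%:C) ->
  (forall z, B z -> 1 <= bc1 (rlin a b z / u) + bc2 (rlin a b z / u)) ->
  (forall z, ctri z -> closure D' (u * z)) ->
  (forall x, 0 <= x <= X -> A' (u * x%:C)) ->
  (forall x, 0 <= x <= 1 -> B' (u * bary (1 - x) x)) ->
  crossing G D A B w -> crossing G D' A' B' (w \o si).
Proof.
move=> posN adjN siK u0 X1 DN AN BN D'u A'u B'u.
move=> [v [s [/and3P[vp vu vw] [t1 [t2 [t10 t12 t2s DL AB]]]]]].
exists (tau v), [seq tau i | i <- s]; split.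
  apply/and3P; split.
  - by rewrite path_map; apply: sub_path vp => i j; exact: adjN.
  - by rewrite -map_cons (map_inj_uniq (can_inj siK)).
  - by rewrite -map_cons all_map; apply: sub_all vw => i /=; rewrite siK.
rewrite size_map -map_cons.
have -> : [seq pos G i | i <- [seq tau i | i <- v :: s]] =
    [seq rlin a b z | z <- [seq pos G i | i <- v :: s]].
  by rewrite -!map_comp; apply: eq_map => i /=; rewrite posN.
pose L := polyline [seq pos G i | i <- v :: s].
pose c t := rlin a b (polygon (pos G v) [seq pos G i | i <- s] t) / u.
have LE t : t1 <= t <= t2 -> rlin a b (L t) = u * c t.
  move=> /andP[tt1 tt2]; rewrite /c mulrC divfK // /L /= polylineE //.
  by rewrite size_map (le_trans t10 tt1) (le_trans tt2 t2s).
have cE t : t1 <= t <= t2 -> c t = rlin a b (L t) / u.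
  by move=> tt; rewrite LE // mulrC mulKf.
have cC : continuous c.
  move=> t; apply: (cvg_mul (nbhs_filter t)); last exact: cvg_cst.
  by apply: cvg_rlin; apply: cvg_polygon; exact: cvg_id.
have cpos t : t1 <= t <= t2 -> 0 <= bc1 (c t) /\ 0 <= bc2 (c t).
  by move=> tt; rewrite cE //; apply/DN/DL.
have startA t : t1 <= t <= t2 -> A (L t) -> exists2 x, 0 <= x <= X & c t = x%:C.
  by move=> tt /AN[x xX e]; exists x => //; rewrite cE // e mulrC mulKf.
have real1 x : 0 <= x <= X -> bc1 x%:C + bc2 x%:C < 1.
  by move=> /andP[_ xX]; rewrite -bary_real bc1_bary bc2_bary addr0; exact: le_lt_trans X1.
case: AB => [[AL BL]|[BL AL]].
- have tt1 : t1 <= t1 <= t2 by rewrite lexx.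
  have tt2 : t1 <= t2 <= t2 by rewrite lexx andbT.
  have [x xX c1] := startA _ tt1 AL.
  have [||t3 [/andP[t13 t32] cT [y y01 cy]]] := first_hit t12 cC cpos.
  + by rewrite c1 real1.
  + by rewrite cE //; exact: BN.
  exists t1, t3; split => //; first exact: le_trans t2s.
  + move=> t tt; rewrite polyline_rlin -/(L t) LE; last by case/andP: tt => -> /le_trans->.
    exact/D'u/cT.
  + left; rewrite !polyline_rlin -/(L t1) -/(L t3) !LE ?t13 ?t32 // c1 cy; split; [exact: A'u|exact: B'u].
- have tt1 : t1 <= t1 <= t2 by rewrite lexx.
  have tt2 : t1 <= t2 <= t2 by rewrite lexx andbT.
  have [x xX c1] := startA _ tt2 AL.
  (* The path runs from B to A: it is followed backwards. *)
  have flip t : t1 <= t <= t2 -> t1 <= t1 + t2 - t <= t2.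
    by move=> /andP[? ?]; apply/andP; split; lra.
  have cC' : continuous (fun t => c (t1 + t2 - t)).
    move=> t; apply: (@continuous_comp _ _ _ (fun t => t1 + t2 - t) c); last exact: cC.
    by apply: cvgB; [exact: cvg_cst|exact: cvg_id].
  have [|||t3 [/andP[t13 t32] cT [y y01 cy]]] := first_hit t12 cC'.
  + by move=> t /flip; exact: cpos.
  + have -> : t1 + t2 - t1 = t2 by ring.
    by rewrite c1 real1.
  + have -> : t1 + t2 - t2 = t1 by ring.
    by rewrite cE //; exact: BN.
  have t3' : t1 <= t1 + t2 - t3 <= t2 by apply: flip; rewrite t13.
  case/andP: (t3') => t13' t32'.
  exists (t1 + t2 - t3), t2; split => //; first exact: le_trans t13'.
  + move=> t /andP[ta tb]; have tt : t1 <= t <= t2 by rewrite tb (le_trans t13').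
    rewrite polyline_rlin -/(L t) LE //.
    have -> : t = t1 + t2 - (t1 + t2 - t) by ring.
    by apply/D'u/cT; apply/andP; split; lra.
  + right; rewrite !polyline_rlin -/(L _) -/(L t2) !LE // c1 cy; split; [exact: B'u|exact: A'u].
Qed.

End CrossingTransfer.

(** * Comparison of two crossing probabilities *)

Section Contradiction.
Context {R : realType}.
Implicit Types (z w : plane R) (x y r s t : R).

Lemma croot_real n x : (0 < n)%N -> 0 <= x -> croot n x%:C = (rroot n x)%:C.
Proof.
move=> n0 x0; have pi0 := pi_gt0 R.
have -> : x%:C = ((rroot n x)%:C * expi 0) ^+ n :> plane R.
  by rewrite expi0 mulr1 -rmorphXn rrootK.
by rewrite croot_polar ?rroot_ge0 ?mul0rn ?normr0 ?divr_ge0 ?expi0 ?mulr1 // ltW.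
Qed.

(** The power w^(m/n) of a point of the triangle in the oblique coordinates
    given by the sides of the sector. *)
Lemma sector_coords n m w : (0 < n)%N -> (n <= m)%N -> (2 * m < 3 * n)%N -> ctri w ->
  exists r x y, [/\ 0 <= r, 0 <= x, 0 <= y, r ^+ n = cmod w & r ^+ m <= x + y] /\
    croot n w ^+ m = x%:C + y%:C * expi (pi / 3 / n%:R *+ m).
Proof.
move=> n0 nm mn Tw; have pi0 := pi_gt0 R.
have [r [a [[r0 _ aA wE] uE]]] := ctri_polar n0 Tw.
have m0 : (0 < m)%N := leq_trans n0 nm.
set be := pi / 3 / n%:R *+ m.
have A0 : 0 < pi / 3 / n%:R :> R by rewrite !divr_gt0 ?ltr0n.
have be0 : 0 < be by rewrite /be mulrn_wgt0.
have be1 : be < pi / 2 by apply: (angle_bound n0 mn) => //; rewrite lexx ltW.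
set th := a *+ m.
case/andP: (aA) => a0 a1.
have th0 : 0 <= th by rewrite mulrn_wge0.
have th1 : th <= be by rewrite /th /be lerMn2r a1 orbT.
have sb : 0 < sin be by apply: sin_gt0_pi; apply/andP; split; lra.
have s1 : 0 <= sin th by apply: sin_ge0_pi; apply/andP; split; lra.
have s2 : 0 <= sin (be - th) by apply: sin_ge0_pi; apply/andP; split; lra.
have rm0 : 0 <= r ^+ m by exact: exprn_ge0.
have e1 : croot n w ^+ m = (r ^+ m * sin (be - th) / sin be)%:C +
    (r ^+ m * sin th / sin be)%:C * expi be.
  rewrite uE polarX -/th; apply: complexP; rewrite ?(cReD, cImD, cReM, cImM) /=.
    by rewrite sinB; field; rewrite gt_eqF.
  by field; rewrite gt_eqF.
have x0 : 0 <= r ^+ m * sin (be - th) / sin be by rewrite divr_ge0 ?mulr_ge0 // ltW.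
have y0 : 0 <= r ^+ m * sin th / sin be by rewrite divr_ge0 ?mulr_ge0 // ltW.
have cu : cmod (croot n w ^+ m) = r ^+ m.
  by rewrite uE polarX cmodM cmod_expi mulr1 cmod_real ger0_norm.
move: e1 x0 y0; move: (_ / _) (r ^+ m * sin th / sin be) => x y e1 x0 y0.
exists r, x, y; split => //; split => //.
  by rewrite wE polarX cmodM cmod_expi mulr1 cmod_real ger0_norm // exprn_ge0.
rewrite -cu e1; apply: le_trans (cmodD _ _) _.
by rewrite cmodM cmod_expi mulr1 !cmod_real !ger0_norm.
Qed.

(** For m = n = 1 the map is linear and the sector is a true triangle. *)
Lemma secmap11 (u : plane R) z : 0 <= Re z -> secmap 1 1 u z = u * z.
Proof. by move=> z0; rewrite /secmap crootK. Qed.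

(** A linear symmetry of the lattices takes p to u, and takes a direction at
    angle (n + 1) pi / 3n from p into the angle spanned by u and u omega, whose
    opening is pi / 3. The sector of exponent (n + 1) / n spanned by the former
    two directions is then compared with the triangle of base u. *)
Lemma no_cardy_wedge (P : R -> probability configT R) (G : R -> lattice R)
    (tau si : int * int -> int * int) (a b p u : plane R) (s t : R) (n : nat) :
  (forall p : R, 0 <= p <= 1 -> product_bernoulli p (P p)) ->
  (forall d v, rlin a b (pos (G d) v) = pos (G d) (tau v)) ->
  (forall d v v', adj (G d) v v' -> adj (G d) (tau v) (tau v')) ->
  cancel tau si -> cancel si tau -> (3 <= n)%N ->
  p != 0 -> u != 0 -> 0 <= s -> 0 < t ->
  rlin a b p = u -> rlin a b (p * expi (pi / 3 / n%:R *+ n.+1)) = u * bary s t ->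
  ~ cardy_formula P G.
Proof.
move=> hP posN adjN tauK siK n3 p0 u0 s0 t0 Np NpY cardy.
have n0 : (0 < n)%N by exact: leq_trans n3.
have mn : (2 * n.+1 < 3 * n)%N.
  by rewrite mulnS (mulSn 2 n) ltn_add2r.
(* In the oblique coordinates (x, y) of the sector, the side of the triangle
   opposite to 0 is reached as soon as ka mu (x + y) is at least 1; since
   x + y >= 1/4 on the far side of the sector, ka = 4 / mu is enough. *)
pose mu := Num.min 1 (s + t).
have mu0 : 0 < mu by rewrite lt_min ltr01 ltr_wpDl.
have mu1 : mu <= 1 by rewrite ge_min lexx.
have mu2 : mu <= s + t by rewrite ge_min lexx orbT.
pose ka := 4 / mu.
have ka4 : 4 <= ka by rewrite ler_pdivlMr //; lra.
have ka0 : 0 <= ka := le_trans (ler0n _ 4) ka4.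
have kamu : ka * mu = 4 by rewrite divfK // gt_eqF.
pose ze : plane R := ka%:C * p.
have ze0 : ze != 0 by rewrite mulf_neq0 // eq_complex /= negb_and; apply/orP; left; rewrite gt_eqF //; lra.
(* The marked points have conformal coordinates X2 = r2^n in the sector and
   X1 = ka r2^(n+1) in the triangle; r2 is such that X1 < X2. *)
pose r2 := (2 * ka)^-1.
have r20 : 0 < r2 by rewrite invr_gt0; lra.
have r21 : r2 < 1 by rewrite invf_lt1; lra.
have kar : ka * r2 = 1 / 2 by rewrite /r2; field; rewrite gt_eqF //; lra.
pose X2 := r2 ^+ n; pose X1 := ka * r2 ^+ n.+1.
have X20 : 0 < X2 by exact: exprn_gt0.
have X21 : X2 < 1 by rewrite exprn_ilt1 ?(ltW r20) // -lt0n.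
have X12 : X1 = X2 / 2 by rewrite /X1 exprS mulrA kar mulrC mulrA mulr1.
have nm := leqnSn n.
have lt23 : (2 * 1 < 3 * 1)%N by [].
pose D2 := secdom n n.+1 ze; pose D1 := secdom 1 1 u.
pose A2 := bdarc D2 (secmap n n.+1 ze 0) (secmap n n.+1 ze X2%:C).
pose B2 := bdarc D2 (secmap n n.+1 ze 1) (secmap n n.+1 ze omega).
pose A1 := bdarc D1 (secmap 1 1 u 0) (secmap 1 1 u X1%:C).
pose B1 := bdarc D1 (secmap 1 1 u 1) (secmap 1 1 u omega).
have X1_gt0 : 0 < X1 by lra.
have X1_lt1 : X1 < 1 by lra.
have TX x : 0 < x < 1 -> ctri (x%:C : plane R).
  by move=> /andP[x0 x1]; rewrite -bary_real; apply: ctri_bary; lra.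
have c2 : crossing_prob P (G d) D2 A2 B2 @[d --> 0^'+] --> X2.
  have X2I : 0 < X2 < 1 by rewrite X20.
  apply: (cardy _ _ _ _ _ (secinv n n.+1 ze) X2 (secdom_jordan n0 nm mn ze0)
    (secdom_ccw4 n0 nm mn ze0 X2I) (secdom_cardy n0 nm mn ze0)).
  exact: (secmapK n0 nm mn ze0 (TX _ X2I)).
have c1 : crossing_prob P (G d) D1 A1 B1 @[d --> 0^'+] --> X1.
  have X1I : 0 < X1 < 1 by rewrite X1_gt0.
  apply: (cardy _ _ _ _ _ (secinv 1 1 u) X1 (secdom_jordan (ltn0Sn 0) (leqnn 1) lt23 u0)
    (secdom_ccw4 (ltn0Sn 0) (leqnn 1) lt23 u0 X1I) (secdom_cardy (ltn0Sn 0) (leqnn 1) lt23 u0)).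
  exact: (secmapK (ltn0Sn 0) (leqnn 1) lt23 u0 (TX _ X1I)).
pose Y : plane R := expi (pi / 3 / n%:R *+ n.+1).
have NE x y : rlin a b (ze * (x%:C + y%:C * Y)) = u * bary (ka * (x + y * s)) (ka * (y * t)).
  have -> : ze * (x%:C + y%:C * Y) = (ka * x)%:C * p + (ka * y)%:C * (p * Y).
    by rewrite /ze !rmorphM /=; ring.
  rewrite rlinD !rlinZ Np NpY /bary !rmorphM !rmorphD /= !rmorphM /=; ring.
have key w : ctri w -> exists x y, [/\ 0 <= x, 0 <= y,
    rlin a b (secmap n n.+1 ze w) / u = bary (ka * (x + y * s)) (ka * (y * t)) &
    (1/2 <= cmod w -> 1/4 <= x + y)].
  move=> Tw; have [r [x [y [[r0 x0 y0 rn rm] e]]]] := sector_coords n0 nm mn Tw.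
  exists x, y; split => //; first by rewrite /secmap e NE mulrC mulKf.
  move=> w2; apply: le_trans rm.
  have rn1 : r ^+ n <= 1 by rewrite rn; exact: ctri_cmod.
  have r1 : r <= 1 by rewrite -(expr_le1 n0 r0).
  have rr : r ^+ n <= r by rewrite ler_iXnr.
  by rewrite exprS; rewrite -rn in w2; nra.
have cmp d : crossing_prob P (G d) D2 A2 B2 <= crossing_prob P (G d) D1 A1 B1.
  apply: (crossing_prob_le hP (can_inj siK)) => w.
  apply: (crossing_transfer (posN d) (adjN d) tauK u0 X1_lt1).
  - move=> z; rewrite /D2 (closure_secdom n0 nm mn ze0) => -[v Tv <-].
    have [x [y [x0 y0 -> _]]] := key _ Tv; rewrite bc1_bary bc2_bary.
    split; apply: mulr_ge0 => //; last by rewrite mulr_ge0 // ltW.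
    by rewrite addr_ge0 // mulr_ge0.
  - move=> z; rewrite /A2 /D2 (secdom_arc0 n0 nm mn ze0 (ltW X20) (ltW X21)).
    move=> [x + <-]; rewrite /= in_itv /= => /andP[x0 x1].
    exists (ka * rroot n x ^+ n.+1).
      rewrite mulr_ge0 ?exprn_ge0 ?rroot_ge0 //= /X1 ler_wpM2l //.
      apply: lerXn2r; rewrite ?nnegrE ?rroot_ge0 ?(ltW r20) //.
      rewrite -(rrootX n0 (ltW r20)) -/X2 /rroot.
      by apply: ge0_ler_powR; rewrite ?nnegrE ?invr_ge0 ?ler0n ?(ltW X20).
    rewrite /secmap (croot_real n0 x0) -rmorphXn /=.
    have -> : ze * (rroot n x ^+ n.+1)%:C = ze * ((rroot n x ^+ n.+1)%:C + 0%:C * Y).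
      by rewrite mul0r addr0.
    by rewrite NE !mul0r addr0 mulr0 bary_real.
  - move=> z; rewrite /B2 /D2 (secdom_arc1 n0 nm mn ze0) => -[v + <-].
    rewrite /= in_itv /= => /andP[v0 v1].
    have Tv : ctri (bary (1 - v) v) by apply: ctri_bary; lra.
    have [x [y [x0 y0 -> h]]] := key _ Tv; rewrite bc1_bary bc2_bary.
    have : 1/4 <= x + y.
      apply: h; apply: le_trans (Re_le_cmod _); rewrite /bary cReD cReM Re_omega Im_omega /= ger0_norm; lra.
    have h1 : ka * (x + y * s) + ka * (y * t) = ka * (x + y * (s + t)) by ring.
    move=> xy; rewrite h1; have : mu * (x + y) <= x + y * (s + t) by nra.
    move=> /(ler_wpM2l ka0); rewrite mulrA kamu; lra.
  - move=> z Tz; rewrite /D1 (closure_secdom (ltn0Sn 0) (leqnn 1) lt23 u0).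
    by exists z => //; apply: secmap11; exact: ctri_Re.
  - move=> x /andP[x0 x1]; rewrite /A1 /D1 (secdom_arc0 (ltn0Sn 0) (leqnn 1) lt23 u0 (ltW X1_gt0) (ltW X1_lt1)).
    exists x; first by rewrite /= in_itv /= x0.
    by apply: secmap11.
  - move=> x /andP[x0 x1]; rewrite /B1 /D1 (secdom_arc1 (ltn0Sn 0) (leqnn 1) lt23 u0).
    exists x; first by rewrite /= in_itv /= x0.
    by apply: secmap11; apply: ctri_Re; apply: ctri_bary; lra.
have : X2 <= X1.
  by apply: (ler_cvg_to c2 c1); near=> d; exact: cmp.
by rewrite X12; lra.
Unshelve. all: by end_near. Qed.
End Contradiction.

(** * A linear map that opens an angle *)

Section WedgeChoice.
Context {R : realType}.
Implicit Types (z w : plane R) (x y r s t : R).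

(** The general real-linear map of the plane, with its complex-linear and
    antilinear parts. It preserves orientation if cmod be < cmod al, and it is
    a similarity only if one of the two parts vanishes. *)
Definition clin (al be : plane R) z : plane R := al * z + be * conjc z.

Lemma clinD al be z w : clin al be (z + w) = clin al be z + clin al be w.
Proof.
by rewrite /clin; case: z => ? ?; case: w => ? ?; apply: complexP;
  rewrite ?(cReD, cImD, cReM, cImM) /=; ring.
Qed.

Lemma clinZ al be x z : clin al be (x%:C * z) = x%:C * clin al be z.
Proof.
by rewrite /clin; case: z => ? ?; apply: complexP;
  rewrite ?(cReD, cImD, cReM, cImM) /=; ring.
Qed.

Lemma mul_conjc z : z * conjc z = (cmod z ^+ 2)%:C.
Proof.
by rewrite cmodE2; case: z => ? ?; apply: complexP; rewrite ?(cReM, cImM) /=; ring.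
Qed.

Lemma wedge_Im (al be u : plane R) :
  Im (conjc (clin al be u) * clin al be (u * omega)) =
  height * (cmod al ^+ 2 - cmod be ^+ 2) * cmod u ^+ 2.
Proof.
have omE : omega = 2^-1 +i* height :> plane R by apply: complexP; rewrite ?Re_omega.
rewrite /clin !cmodE2 omE; case: u => x y; case: al => a1 a2; case: be => c1 c2.
by rewrite ?(cReD, cImD, cReM, cImM) /=; field.
Qed.

Lemma wedge_Re (al be u : plane R) :
  Re (conjc (clin al be u) * clin al be (u * omega)) =
  (cmod al ^+ 2 + cmod be ^+ 2) / 2 * cmod u ^+ 2 +
  Re (al * conjc be * u ^+ 2) - 2 * height * Im (al * conjc be * u ^+ 2).
Proof.
have omE : omega = 2^-1 +i* height :> plane R by apply: complexP; rewrite ?Re_omega.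
rewrite /clin !cmodE2 omE; case: u => x y; case: al => a1 a2; case: be => c1 c2.
by rewrite expr2 ?(cReD, cImD, cReM, cImM) /=; field.
Qed.

(** A map that preserves orientation and is not a similarity takes some angle
    of opening pi / 3 to a larger one. With Q = conj p q, where p and q are the
    images of u and u omega, Im (Q expi (- pi / 3)) is a quadratic form in u, and
    it is positive for u^2 = omega^2 be (conj al). *)
Lemma wide_angle (al be : plane R) : be != 0 -> cmod be < cmod al ->
  exists2 u, u != 0 &
    let Q := conjc (clin al be u) * clin al be (u * omega) in
    0 < Im Q /\ 0 < Im (Q * expi (- (pi / 3))).
Proof.
move=> be0 beal.
have cb : 0 < cmod be by rewrite cmod_gt0.
pose u : plane R := sqrtc (omega ^+ 2 * be * conjc al).
have uu : u ^+ 2 = omega ^+ 2 * be * conjc al by exact: sqr_sqrtc.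
have ca : cmod (conjc al : plane R) = cmod al by case: (al) => ? ?; rewrite /cmod /= sqrrN.
have e : cmod u ^+ 2 = cmod be * cmod al.
  have <- : cmod (u ^+ 2) = cmod u ^+ 2 by rewrite !expr2 cmodM.
  by rewrite uu !cmodM ca cmod_expi !mul1r.
have u0 : u != 0.
  rewrite -cmod_eq0; apply: contraTneq (mulr_gt0 cb (lt_trans cb beal)) => u0.
  by rewrite -e u0 expr0n ltxx.
have W : al * conjc be * u ^+ 2 = (cmod al ^+ 2 * cmod be ^+ 2)%:C * omega ^+ 2.
  have -> : (cmod al ^+ 2 * cmod be ^+ 2)%:C = al * conjc al * (be * conjc be) :> plane R.
    by rewrite !mul_conjc -rmorphM.
  by rewrite uu; ring.
have [WR WI] : Re (al * conjc be * u ^+ 2) = - (cmod al ^+ 2 * cmod be ^+ 2) / 2 /\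
    Im (al * conjc be * u ^+ 2) = (cmod al ^+ 2 * cmod be ^+ 2) * height.
  by rewrite W omega2 cReM cImM cReB cImB Re_omega Im_omega /=; split; field.
exists u => //=.
set Q := conjc _ * _.
have QI := wedge_Im al be u; have QR := wedge_Re al be u.
rewrite -/Q in QI QR.
have h0 : (0 : R) < height := height_gt0; have h2 : height ^+ 2 = 3 / 4 :> R := height2.
have ae : 0 < cmod al by exact: lt_trans beal.
have bb : cmod be ^+ 2 < cmod al ^+ 2 by rewrite ltrXn2r ?nnegrE ?cmod_ge0.
split; first by rewrite QI e !mulr_gt0 // subr_gt0.
rewrite cImM /= cosN sinN cos_pi3 -/height QR QI WR WI e.
move: (cmod al) (cmod be) cb ae beal => A B B0 A0 AB.
have -> : ((A ^+ 2 + B ^+ 2) / 2 * (B * A) + - (A ^+ 2 * B ^+ 2) / 2 - 2 * height * (A ^+ 2 * B ^+ 2 * height)) * - height +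
  height * (A ^+ 2 - B ^+ 2) * (B * A) / 2 =
  height * (A * B ^+ 2) * (A / 2 - B) + height * (A ^+ 2 * B ^+ 2) * 2 * height ^+ 2 by field.
rewrite h2.
have -> : height * (A * B ^+ 2) * (A / 2 - B) + height * (A ^+ 2 * B ^+ 2) * 2 * (3 / 4) =
  height * (A * B ^+ 2) * (2 * A - B) by field.
by rewrite !mulr_gt0 ?exprn_gt0 //; lra.
Qed.

(** The coordinates of x expi t in the basis (x, Q), where x is real. *)
Lemma oblique_coords (Q : plane R) x t : Im Q != 0 ->
  x%:C * expi t =
  (Im (Q * expi (- t)) / Im Q)%:C * x%:C + (x * Im (expi t) / Im Q)%:C * Q.
Proof.
case: Q => a b /= b0.
apply: complexP; rewrite ?(cReD, cImD, cReM, cImM) /= cosN sinN; field; exact: b0.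
Qed.

(** The image of the angle spanned by u and u omega contains an angle with first
    side the image of u and opening (n + 1) pi / 3n, for n large. *)
Lemma wedge_choice (al be : plane R) : be != 0 -> cmod be < cmod al ->
  exists (u : plane R) (s t : R) (n : nat),
  [/\ (3 <= n)%N, u != 0, clin al be u != 0, 0 <= s /\ 0 < t &
    clin al be u * expi (pi / 3 / n%:R *+ n.+1) = clin al be (u * bary s t)].
Proof.
move=> be0 beal; have pi0 := pi_gt0 R.
have [u u0 /=] := wide_angle be0 beal.
set p := clin al be u; set q := clin al be (u * omega); set Q := conjc p * q.
move=> [Q0 Q3].
have p0 : p != 0.
  apply: contraTneq Q0 => p0; rewrite /Q p0.
  by rewrite cImM /= oppr0 !mul0r addr0 ltxx.
pose th N : R := pi / 3 + pi / 3 * harmonic N.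
have thc : th @ \oo --> pi / 3 + pi / 3 * 0.
  apply: cvgD; first exact: cvg_cst.
  by apply: cvgM; [exact: cvg_cst|exact: cvg_harmonic].
rewrite mulr0 addr0 in thc.
have kc : Im (Q * expi (- th N)) @[N --> \oo] --> Im (Q * expi (- (pi / 3))).
  by apply: cvg_Im; apply: cvg_mul; [exact: cvg_cst|apply: cvg_expi; exact: cvgN].
have : \forall N \near \oo, 0 < Im (Q * expi (- th N)) /\ (3 <= N)%N.
  near=> N; split; last by near: N; exists 3%N.
  by near: N; exact: (cvgr_gt _ kc _ Q3).
move=> [N _ /(_ N (leqnn N)) /= [kN N3]].
pose Y : plane R := expi (th N).
have YE : expi (pi / 3 / N.+1%:R *+ N.+2) = Y.
  rewrite /Y /th /harmonic; congr expi.
  rewrite -(mulr_natr (_ / _)) -[N.+2]addn1 natrD /=; field.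
  by rewrite nat1r pnatr_eq0.
have Y0 : 0 < Im Y.
  have hN : (0 : R) < harmonic N <= (1 : R) / 2.
    rewrite /harmonic invr_gt0 ltr0n /= div1r lef_pV2 ?posrE ?ltr0n // ler_nat.
    exact: (leq_trans (ltnW N3) (leqnSn N)).
  by case/andP: hN => h1 h2; apply: sin_gt0_pi; rewrite /th; apply/andP; split; nra.
pose t := cmod p ^+ 2 * Im Y / Im Q.
pose s := Im (Q * expi (- th N)) / Im Q.
exists u, s, t, N.+1; split => //.
- by rewrite ltnW.
- split; first by rewrite divr_ge0 // ltW.
  by rewrite divr_gt0 // mulr_gt0 // exprn_gt0 // cmod_gt0.
rewrite YE.
have -> : u * bary s t = s%:C * u + t%:C * (u * omega) by rewrite /bary; ring.
rewrite clinD !clinZ -/p -/q.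
have cp0 : conjc p != 0 by rewrite conjc_eq0.
apply: (mulfI cp0); rewrite mulrDr [LHS]mulrA (mulrC (conjc p) p) mul_conjc.
rewrite [conjc p * (s%:C * p)]mulrCA (mulrC (conjc p) p) mul_conjc.
rewrite [conjc p * (t%:C * q)]mulrCA -/Q /s /t /Y.
have Qn0 : Im Q != 0 by rewrite gt_eqF.
exact: oblique_coords.
Unshelve. all: by end_near. Qed.

End WedgeChoice.

(** * The two families of lattices *)

Section Lattices.
Context {R : realType}.
Implicit Types (z w : plane R) (x y r s t : R).

Lemma pmN (l : seq (plane R)) z : z \in pm l -> - z \in pm l.
Proof.
rewrite /pm !mem_cat => /orP[zl|/mapP[y yl ->]]; apply/orP.
  by right; apply/mapP; exists z.
by left; rewrite opprK.
Qed.

Lemma pm_mem (l : seq (plane R)) z : z \in l -> z \in pm l.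
Proof. by rewrite /pm mem_cat => ->. Qed.

Lemma pm_rlin a b (l : seq (plane R)) :
  (forall z, z \in l -> rlin a b z \in pm l) ->
  forall z, z \in pm l -> rlin a b z \in pm l.
Proof.
move=> lN z; rewrite {1}/pm mem_cat => /orP[/lN//|/mapP[y /lN yl ->]].
have -> : rlin a b (- y) = - rlin a b y.
  have := rlinZ a b (-1) y; rewrite rmorphN rmorph1 !mulN1r; exact.
exact: pmN.
Qed.

Lemma adj_rlin (G : lattice R) a b tau :
  (forall v, rlin a b (pos G v) = pos G (tau v)) ->
  (forall z, z \in steps G -> rlin a b z \in steps G) ->
  forall v v', adj G v v' -> adj G (tau v) (tau v').
Proof.
move=> posN stepN v v' /stepN; rewrite /adj -!posN.
have -> // : rlin a b (pos G v' - pos G v) = rlin a b (pos G v') - rlin a b (pos G v).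
have := rlinZ a b (-1) (pos G v); rewrite rmorphN rmorph1 !mulN1r rlinD => ->.
by [].
Qed.

(** Cardy's formula fails as soon as the lattices have a linear symmetry, here
    the inverse of [clin al be], that preserves orientation and is not a
    similarity. *)
Lemma no_cardy_symmetry (P : R -> probability configT R) (G : R -> lattice R)
    (tau si : int * int -> int * int) (a b al be : plane R) :
  (forall p : R, 0 <= p <= 1 -> product_bernoulli p (P p)) ->
  (forall d v, rlin a b (pos (G d) v) = pos (G d) (tau v)) ->
  (forall d z, z \in steps (G d) -> rlin a b z \in steps (G d)) ->
  cancel tau si -> cancel si tau ->
  (forall z, rlin a b (clin al be z) = z) -> be != 0 -> cmod be < cmod al ->
  ~ cardy_formula P G.
Proof.
move=> hP posN stepN tauK siK NM be0 beal.
have [u [s [t [n [n3 u0 p0 [s0 t0] pY]]]]] := wedge_choice be0 beal.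
apply: (no_cardy_wedge hP posN (fun d => adj_rlin (posN d) (stepN d)) tauK siK n3 p0 u0 s0 t0).
  exact: NM.
by rewrite pY NM.
Qed.

Lemma cmod_lt z w : Re z ^+ 2 + Im z ^+ 2 < Re w ^+ 2 + Im w ^+ 2 -> cmod z < cmod w.
Proof. by move=> h; rewrite /cmod ltr_sqrt //; apply: le_lt_trans h; rewrite addr_ge0 ?sqr_ge0. Qed.

(** The symmetry of order six of the triangular lattice, read on the labels of
    the vertices of each family ([turnT], [turnS]), and its inverse. It turns
    each of the six steps into the previous one in counterclockwise order. *)
Definition turnT (v : int * int) : int * int := (v.1 + v.2, - v.1).
Definition unturnT (v : int * int) : int * int := (- v.2, v.1 + v.2).
Definition turnS (v : int * int) : int * int := (v.2, v.2 - v.1).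
Definition unturnS (v : int * int) : int * int := (v.1 - v.2, v.1).

Lemma lattice_T_no_cardy (P : R -> probability configT R) (k : R) :
  (forall p : R, 0 <= p <= 1 -> product_bernoulli p (P p)) ->
  2^-1 < k -> k <> 1 -> ~ cardy_formula P (lattice_T k).
Proof.
move=> hP k2 k1; pose h := Num.sqrt (k ^+ 2 - 4^-1).
have hh0 : 0 < k ^+ 2 - 4^-1 by nra.
have h0 : 0 < h by rewrite sqrtr_gt0.
have h2 : h ^+ 2 = k ^+ 2 - 4^-1 by rewrite sqr_sqrtr // ltW.
have hn0 : h != 0 by rewrite gt_eqF.
(* rlin a b takes the step 1 to (1, - 2 h) / 2 and (1, 2 h) / 2 to 1; its
   inverse has complex-linear part al and antilinear part be, and be = 0 only
   if h^2 = 3/4, that is k = 1. *)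
pose a : plane R := 2^-1 -i* h.
pose b : plane R := (3 / (4 * h)) +i* 2^-1.
pose al : plane R := 2^-1 +i* ((h + 3 / (4 * h)) / 2).
pose be : plane R := 0 +i* ((h - 3 / (4 * h)) / 2).
apply: (@no_cardy_symmetry P (lattice_T k) turnT unturnT a b al be hP).
- move=> d [i j]; rewrite /turnT /= -/h intrD mulrNz.
  by apply: complexP; rewrite /rlin ?(cReD, cImD, cReM, cImM) /=; field.
- move=> d; apply: pm_rlin => z zl.
  have {zl} : [|| z == d +i* 0, z == (d / 2) +i* (d * h) |
      z == (- (d / 2)) +i* (d * h)] by rewrite !inE in zl.
  move=> /or3P[]/eqP->.
  + have -> : rlin a b (d +i* 0) = - ((- (d / 2)) +i* (d * h)).
      by apply: complexP; rewrite /rlin ?(cReD, cImD, cReM, cImM) /=; field.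
    by apply/pmN/pm_mem; rewrite !inE eqxx ?orbT.
  + have -> : rlin a b ((d / 2) +i* (d * h)) = d +i* 0.
      by apply: complexP; rewrite /rlin ?(cReD, cImD, cReM, cImM) /=; field.
    by apply: pm_mem; rewrite !inE eqxx.
  + have -> : rlin a b ((- (d / 2)) +i* (d * h)) = (d / 2) +i* (d * h).
      by apply: complexP; rewrite /rlin ?(cReD, cImD, cReM, cImM) /=; field.
    by apply: pm_mem; rewrite !inE eqxx ?orbT.
- by move=> [i j]; rewrite /unturnT /turnT /=; congr (_, _); ring.
- by move=> [i j]; rewrite /unturnT /turnT /=; congr (_, _); ring.
- move=> [x y]; apply: complexP; rewrite /rlin /clin ?(cReD, cImD, cReM, cImM) /=; field; exact: hn0.
- rewrite eq_complex /= eqxx /= mulf_neq0 ?invr_eq0 ?pnatr_eq0 // subr_eq0.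
  apply/eqP => hE; apply: k1.
  have : h ^+ 2 = 3 / 4 by rewrite expr2 {1}hE; field.
  rewrite h2 => k4; have : (k - 1) * (k + 1) = 0 by lra.
  by move=> /eqP; rewrite mulf_eq0 => /orP[]/eqP; lra.
- apply: cmod_lt => /=; rewrite -subr_gt0.
  have -> // : 2^-1 ^+ 2 + ((h + 3 / (4 * h)) / 2) ^+ 2 -
     (0 ^+ 2 + ((h - 3 / (4 * h)) / 2) ^+ 2) = 1 by field.
Qed.

Lemma lattice_Sne_no_cardy (P : R -> probability configT R) :
  (forall p : R, 0 <= p <= 1 -> product_bernoulli p (P p)) ->
  ~ cardy_formula P (@lattice_Sne R).
Proof.
move=> hP.
(* rlin a b takes 1 to - i and i to 1 + i. *)
pose a : plane R := 0 -i* 1.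
pose b : plane R := 1 +i* 1.
pose al : plane R := 2^-1 +i* 1.
pose be : plane R := 2^-1 +i* 0.
apply: (@no_cardy_symmetry P (@lattice_Sne R) turnS unturnS a b al be hP).
- move=> d [i j]; rewrite /turnS /= intrB.
  by apply: complexP; rewrite /rlin ?(cReD, cImD, cReM, cImM) /=; ring.
- move=> d; apply: pm_rlin => z zl.
  have {zl} : [|| z == d +i* 0, z == 0 +i* d | z == d +i* d] by rewrite !inE in zl.
  move=> /or3P[]/eqP->.
  + have -> : rlin a b (d +i* 0) = - (0 +i* d).
      by apply: complexP; rewrite /rlin ?(cReD, cImD, cReM, cImM) /=; ring.
    by apply/pmN/pm_mem; rewrite !inE eqxx ?orbT.
  + have -> : rlin a b (0 +i* d) = d +i* d.
      by apply: complexP; rewrite /rlin ?(cReD, cImD, cReM, cImM) /=; ring.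
    by apply: pm_mem; rewrite !inE eqxx ?orbT.
  + have -> : rlin a b (d +i* d) = d +i* 0.
      by apply: complexP; rewrite /rlin ?(cReD, cImD, cReM, cImM) /=; ring.
    by apply: pm_mem; rewrite !inE eqxx.
- by move=> [i j]; rewrite /unturnS /turnS /=; congr (_, _); ring.
- by move=> [i j]; rewrite /unturnS /turnS /=; congr (_, _); ring.
- by move=> [x y]; apply: complexP; rewrite /rlin /clin ?(cReD, cImD, cReM, cImM) /=; field.
- by rewrite eq_complex /= negb_and invr_eq0 pnatr_eq0.
- by apply: cmod_lt => /=; rewrite expr0n addr0 ltrDl expr1n.
Qed.

End Lattices.

Local Open Scope ring_scope.

Theorem mainTheorem1 (R : realType) (P : R -> probability configT R)
    (hP : forall p : R, 0 <= p <= 1 -> product_bernoulli p (P p)) :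
  (forall k : R, 2^-1 < k -> k <> 1 -> ~ cardy_formula P (lattice_T k)) /\
  ~ cardy_formula P (@lattice_Sne R).
Proof.
split; last exact: lattice_Sne_no_cardy.
by move=> k; exact: lattice_T_no_cardy.
Qed.
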